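(* For arbitrary $t\in(0,1/2)$ and $\delta>0$, $$\lim_{n\to\infty}-\frac{1}{n^{1-2t}}\log\Pr\left\{\tilde g^n(X^{n+1})-n\eta(0)\ge n^{1-t}\delta\right\}=\frac{\delta^2}{2\frac{d^2\phi}{d\theta^2}(0)},$$ $$\lim_{n\to\infty}-\frac{1}{n^{1-2t}}\log\Pr\left\{\tilde g^n(X^{n+1})-n\eta(0)\le -n^{1-t}\delta\right\}=\frac{\delta^2}{2\frac{d^2\phi}{d\theta^2}(0)}.$$
   Context: $\mathcal X$ is a finite set. A transition matrix $W$ on $\mathcal X$ has entries $W(x|\bar x)\ge 0$ with $\sum_x W(x|\bar x)=1$ for each $\bar x$. $W_0$ is an irreducible and ergodic (i.e. irreducible and aperiodic) transition matrix on $\mathcal X$, $P_0$ an arbitrary probability distribution on $\mathcal X$, $g:\mathcal X\times\mathcal X\to\mathbb R$ and $h:\mathcal X\to\mathbb R$ functions. It is assumed that there are no $f:\mathcal X\to\mathbb R$ and $c\in\mathbb R$ with $g(x,\bar x)=f(x)-f(\bar x)+c$ for all $(x,\bar x)$ with $W_0(x|\bar x)>0$. The chain $X^{n+1}=(X_1,\dots,X_{n+1})$ has $X_1\sim P_0$ and $\Pr(X_{i+1}=x|X_i=\bar x)=W_0(x|\bar x)$; $\Pr$ is the law of this chain, and $\tilde g^n(X^{n+1}):=\sum_{i=1}^n g(X_{i+1},X_i)+h(X_1)$. $\phi(\theta)$ is the logarithm of the Perron-Frobenius eigenvalue of the matrix $W_0(x|\bar x)e^{\theta g(x,\bar x)}$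 (under the assumption on $g$, $\phi''>0$), and $\eta(0):=\phi'(0)$. *)

(* Defs.v *)
From mathcomp Require Import all_boot all_order all_algebra.
From mathcomp Require Import all_classical all_reals all_analysis.
From mathcomp Require Import complex.

Set Implicit Arguments.
Unset Strict Implicit.
Unset Printing Implicit Defensive.

Import Order.TTheory GRing.Theory Num.Theory.
Import numFieldNormedType.Exports.

Local Open Scope classical_set_scope.
Local Open Scope ring_scope.

Definition distribution_on (R : realType) (X : finType) (p : X -> R) : Prop :=
  (forall x, 0 <= p x) /\ \sum_x p x = 1.

(* Throughout, [W x y] is the probability W(x|y) of moving from y to x, so it is
   the columns, not the rows, that sum to 1. *)
Definition transition_matrix (R : realType) (X : finType) (W : X -> X -> R) :
  Prop := forall y, distribution_on (fun x => W x y).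

Definition mx_of (R : realType) (X : finType) (W : X -> X -> R) :
  'M[R]_#|X| := \matrix_(i, j) W (enum_val i) (enum_val j).

Definition pow_entry (R : realType) (X : finType) (W : X -> X -> R) (n : nat)
  (x y : X) : R := (mx_of W ^+ n) (enum_rank x) (enum_rank y).

Definition irreducible (R : realType) (X : finType) (W : X -> X -> R) : Prop :=
  forall x y, exists n : nat, (0 < n)%N /\ 0 < pow_entry W n x y.

Definition aperiodic (R : realType) (X : finType) (W : X -> X -> R) : Prop :=
  forall (x : X) (d : nat),
    (forall n : nat, (0 < n)%N -> 0 < pow_entry W n x x -> (d %| n)%N) ->
    d = 1%N.

Definition ergodic (R : realType) (X : finType) (W : X -> X -> R) : Prop :=
  irreducible W /\ aperiodic W.

Definition is_perron_eigenvalue (R : realType) (m : nat) (A : 'M[R]_m) (r : R) :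
  Prop :=
  eigenvalue A r /\
  forall z : R[i], eigenvalue (map_mx (real_complex R) A) z ->
    `|z| <= real_complex R r.

(* At most one r satisfies [is_perron_eigenvalue A r]; the default value 0 is
   taken only if there is none, which does not happen for a nonnegative A of
   positive size. *)
Definition perron_eigenvalue (R : realType) (m : nat) (A : 'M[R]_m) : R :=
  xget 0 [set r | is_perron_eigenvalue A r].

Definition tilted (R : realType) (X : finType) (W g : X -> X -> R) (theta : R) :
  X -> X -> R := fun x y => W x y * expR (theta * g x y).

Definition phi (R : realType) (X : finType) (W g : X -> X -> R) (theta : R) : R :=
  ln (perron_eigenvalue (mx_of (tilted W g theta))).

Definition eta (R : realType) (X : finType) (W g : X -> X -> R) (theta : R) : R :=
  derive1 (phi W g) theta.

(* A trajectory (X_1, ..., X_(n+1)) is indexed from 0: X_(k+1) is [x k]. For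
   i < n, [widen_ord (leqnSn n) i] has value i and [lift ord0 i] value i + 1. *)
Definition path_prob (R : realType) (X : finType) (P0 : X -> R)
  (W : X -> X -> R) (n : nat) (x : {ffun 'I_n.+1 -> X}) : R :=
  P0 (x ord0) *
  \prod_(i < n) W (x (lift ord0 i)) (x (widen_ord (leqnSn n) i)).

Definition chain_Pr (R : realType) (X : finType) (P0 : X -> R)
  (W : X -> X -> R) (n : nat) (E : pred {ffun 'I_n.+1 -> X}) : R :=
  \sum_(x : {ffun 'I_n.+1 -> X} | E x) path_prob P0 W x.

Definition g_tilde (R : realType) (X : finType) (g : X -> X -> R) (h : X -> R)
  (n : nat) (x : {ffun 'I_n.+1 -> X}) : R :=
  \sum_(i < n) g (x (lift ord0 i)) (x (widen_ord (leqnSn n) i)) + h (x ord0).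

(* Main.v *)
Require Import Defs.
From mathcomp Require Import all_boot all_order all_algebra.
From mathcomp Require Import all_classical all_reals all_analysis.
From mathcomp Require Import complex ring lra.

Set Implicit Arguments.
Unset Strict Implicit.
Unset Printing Implicit Defensive.

Import Order.TTheory GRing.Theory Num.Theory.
Import numFieldNormedType.Exports.

Local Open Scope classical_set_scope.
Local Open Scope ring_scope.

(* Let [A_t] be the tilted matrix. Solving the Poisson equation for [W0] twice
   gives [eta], [s2] and functions [a], [b] such that [exp (t a + t^2 b / 2)] is
   a left eigenvector of [A_t] with eigenvalue [exp (eta t + s2 t^2 / 2)], up to
   a factor [exp (o(t^2))]. By the Collatz-Wielandt inequalities this is the
   second-order expansion of the Perron eigenvalue. As the latter is a simple
   root of the characteristic polynomial, it depends smoothly on [t] by the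
   implicit function theorem, so [phi' 0 = eta] and [phi'' 0 = s2]; the minimum
   principle gives [0 < s2] unless [g] is a coboundary.

   The same approximate eigenvectors bound the moment generating function of
   [g_tilde - n eta] at [s n^-t] by [exp (n^(1 - 2t) (s2 s^2 / 2 + o(1)))], for
   every real [s]. The limit then follows as in the Gartner-Ellis theorem:
   Chernoff's inequality gives the upper bound, an exponential change of measure
   the lower one. *)

(** * Stochastic matrices, the Poisson equation and Perron eigenvalues *)

Section LinearAlgebra.
Context {R : realType} {m : nat}.
Implicit Types (A : 'M[R]_m) (b u v : 'rV[R]_m).

Definition col_stochastic A :=
  (forall i j, 0 <= A i j) /\ (forall j, \sum_i A i j = 1).

Definition mx_irreducible A := forall i j, exists n, 0 < (A ^+ n) i j.

Lemma mxpowS A n : A ^+ n.+1 = A *m A ^+ n.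
Proof. by rewrite exprS mulmxE. Qed.

Lemma col_stochastic_pow A n : col_stochastic A -> col_stochastic (A ^+ n).
Proof.
move=> [A0 A1]; elim: n => [|n [IH0 IH1]].
  split=> [i j|j]; first by rewrite expr0 mxE; case: (i == j).
  rewrite (bigD1 j) //= expr0 mxE eqxx big1 ?addr0// => i ij.
  by rewrite mxE (negbTE ij).
split=> [i j|j]; first by rewrite mxpowS mxE sumr_ge0// => k _; rewrite mulr_ge0.
under eq_bigr do rewrite mxpowS mxE.
rewrite exchange_big/= -[RHS](IH1 j); apply: eq_bigr => k _.
by rewrite -mulr_suml A1 mul1r.
Qed.

Lemma superharmonic_pow A b n : (forall i j, 0 <= A i j) ->
  (forall j, (b *m A) 0 j <= b 0 j) -> forall j, (b *m A ^+ n) 0 j <= b 0 j.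
Proof.
move=> A0 bA; elim: n => [|n IH] j; first by rewrite expr0 mulmx1.
apply: le_trans (bA j); rewrite exprSr -mulmxE mulmxA !mxE.
by apply: ler_sum => k _; rewrite ler_wpM2r// (le_trans _ (IH k))// mxE.
Qed.

(* Minimum principle: the column of [A ^+ n] below a minimiser [j] of [b]
   averages [b] to at most its minimum, hence [b] is minimal wherever this
   column is positive. *)
Lemma superharmonic_const A b : col_stochastic A -> mx_irreducible A ->
  (forall j, (b *m A) 0 j <= b 0 j) -> forall i j, b 0 i = b 0 j.
Proof.
move=> As Ai bA.
suff H j : (forall k, b 0 j <= b 0 k) -> forall i, b 0 i = b 0 j.
  move=> i j.
  have [k _ kmin] := @arg_minP _ _ _ i predT (b 0) isT.
  by transitivity (b 0 k); [|symmetry]; apply: H => l; exact: kmin.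
move=> jmin i; have [n nij] := Ai i j.
have [P0 P1] := col_stochastic_pow n As.
have bAn := superharmonic_pow n As.1 bA j.
apply/eqP; rewrite eq_le jmin andbT leNgt; apply/negP => ij.
suff : b 0 j < b 0 j by rewrite ltxx.
apply: lt_le_trans bAn.
rewrite mxE -[ltLHS]mulr1 -(P1 j) mulr_sumr.
rewrite (bigD1 i)//= [ltRHS](bigD1 i)//=.
apply: ltr_leD; first by rewrite ltr_pM2r.
by apply: ler_sum => k _; rewrite ler_wpM2r.
Qed.

Lemma ones_mul A : col_stochastic A -> const_mx 1 *m A = const_mx 1 :> 'rV[R]_m.
Proof.
move=> [_ A1]; apply/rowP => j; rewrite !mxE -[RHS](A1 j).
by apply: eq_bigr => i _; rewrite mxE mul1r.
Qed.

(* [I - A] with row [i0] replaced by ones: unlike [I - A] itself, this is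
   invertible. *)
Definition ones_row A (i0 : 'I_m) : 'M[R]_m :=
  \matrix_(i, j) if i == i0 then 1 else (1%:M - A) i j.

Lemma mul_ones_row A i0 b j : (b *m ones_row A i0) 0 j =
  b 0 i0 + (\sum_(i | i != i0) b 0 i * (1%:M - A) i j).
Proof.
rewrite mxE (bigD1 i0)//= mxE eqxx mulr1; congr (_ + _).
by apply: eq_bigr => i ii0; rewrite mxE (negbTE ii0).
Qed.

(** Zeroing entry [i0] of a left kernel vector [b] gives [c] with [c A = c + b 0 i0]. According to
    the sign of [b 0 i0], [c] or [- c] is superharmonic, so [c] is constant, hence equal to its
    entry 0 at [i0], and [b] vanishes. *)
Lemma det_ones_row A i0 : col_stochastic A -> mx_irreducible A ->
  \det (ones_row A i0) != 0.
Proof.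
move=> As Ai; apply/det0P => -[b bN0 bN].
pose c := \row_i if i == i0 then 0 else b 0 i.
have E j : (c *m A) 0 j = c 0 j + b 0 i0.
  have /rowP/(_ j) := bN; rewrite mul_ones_row [in RHS]mxE => H.
  have : (c *m (1%:M - A)) 0 j = - b 0 i0.
    rewrite mxE (bigD1 i0)//= [c 0 i0]mxE eqxx mul0r add0r.
    move/eqP : H; rewrite addrC addr_eq0 => /eqP <-.
    by apply: eq_bigr => i ii0; rewrite [c 0 i]mxE (negbTE ii0).
  rewrite mulmxBr mulmx1 => /(congr1 -%R); rewrite opprK.
  by move=> <-; rewrite !mxE; ring.
have cc i j : c 0 i = c 0 j.
  have [b0|b0] := leP (b 0 i0) 0.
    by apply: (superharmonic_const As Ai) => k; rewrite E gerDl.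
  suff : (- c) 0 i = (- c) 0 j by rewrite mxE [RHS]mxE => /oppr_inj.
  apply: (superharmonic_const (b := - c) As Ai) => k.
  by rewrite mulNmx mxE [leRHS]mxE lerN2 E lerDl ltW.
have c0 : c = 0 by apply/rowP => i; rewrite (cc i i0) !mxE eqxx.
case/negP: bN0; apply/eqP/rowP => i; have [->|ii0] := eqVneq i i0.
  by have := E i0; rewrite c0 mul0mx !mxE add0r.
by move/rowP : c0 => /(_ i); rewrite !mxE (negbTE ii0).
Qed.

(** In the solution of [b *m ones_row A i0 = V], entry [i0] multiplies the row of ones and so is the
    constant [s]; the other entries, with 0 put in place [i0], solve the equation. *)
Lemma poisson_mx A (V : 'rV[R]_m) : col_stochastic A -> mx_irreducible A ->
  exists b s, forall j, (b *m A) 0 j - b 0 j + V 0 j = s.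
Proof.
move=> As Ai; case: (posnP m) => [m0|m0].
  by exists 0, 0 => j; have := ltn_ord j; rewrite [X in (_ < X)%N]m0.
pose i0 := Ordinal m0.
have Nu : ones_row A i0 \in unitmx by rewrite unitmxE unitfE det_ones_row.
pose b := V *m invmx (ones_row A i0).
pose c := \row_i if i == i0 then 0 else b 0 i.
exists c, (b 0 i0) => j.
have : (b *m ones_row A i0) 0 j = V 0 j by rewrite mulmxKV.
rewrite mul_ones_row => <-.
have : (c *m (1%:M - A)) 0 j = \sum_(i | i != i0) b 0 i * (1%:M - A) i j.
  rewrite mxE (bigD1 i0)//= [c 0 i0]mxE eqxx mul0r add0r.
  by apply: eq_bigr => i ii0; rewrite [c 0 i]mxE (negbTE ii0).
by move=> <-; rewrite mulmxBr mulmx1 !mxE; ring.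
Qed.

(** Let [q] be the least ratio [v / u], attained at [k]. Then [q u <= v] with equality at [k], and
    applying [A] gives [r q u_k <= (v A)_k <= rho q u_k]. *)
Lemma collatz_le A u v r rho : (forall i j, 0 <= A i j) -> (0 < m)%N ->
  (forall j, 0 < u 0 j) -> (forall j, 0 < v 0 j) -> u *m A = r *: u ->
  (forall j, (v *m A) 0 j <= rho * v 0 j) -> r <= rho.
Proof.
move=> A0 m0 u0 v0 uA vA; pose i0 := Ordinal m0.
have [k _ kmin] := @arg_minP _ _ _ i0 predT (fun i => v 0 i / u 0 i) isT.
set q := v 0 k / u 0 k in kmin.
have q0 : 0 < q by rewrite divr_gt0.
have H i : q * u 0 i <= v 0 i by rewrite -ler_pdivlMr// kmin.
have vk : v 0 k = q * u 0 k by rewrite divfK// gt_eqF.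
have : (q *: u *m A) 0 k <= rho * v 0 k.
  apply: le_trans (vA k); rewrite !mxE; apply: ler_sum => i _.
  by rewrite mxE ler_wpM2r.
rewrite -scalemxAl uA scalerA mxE vk mulrA [q * r]mulrC.
by rewrite !ler_pM2r.
Qed.

(** The same comparison with the greatest ratio [v / u]. *)
Lemma collatz_ge A u v r rho : (forall i j, 0 <= A i j) -> (0 < m)%N ->
  (forall j, 0 < u 0 j) -> (forall j, 0 < v 0 j) -> u *m A = r *: u ->
  (forall j, rho * v 0 j <= (v *m A) 0 j) -> rho <= r.
Proof.
move=> A0 m0 u0 v0 uA vA; pose i0 := Ordinal m0.
have [k _ kmax] := @arg_maxP _ _ _ i0 predT (fun i => v 0 i / u 0 i) isT.
set q := v 0 k / u 0 k in kmax.
have q0 : 0 < q by rewrite divr_gt0.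
have H i : v 0 i <= q * u 0 i by rewrite -ler_pdivrMr//; exact: kmax.
have vk : v 0 k = q * u 0 k by rewrite divfK// gt_eqF.
have : rho * v 0 k <= (q *: u *m A) 0 k.
  apply: le_trans (vA k) _; rewrite !mxE; apply: ler_sum => i _.
  by rewrite mxE ler_wpM2r.
rewrite -scalemxAl uA scalerA mxE vk mulrA [q * r]mulrC.
by rewrite !ler_pM2r.
Qed.

Lemma perron_unique A r s : is_perron_eigenvalue A r ->
  is_perron_eigenvalue A s -> r = s.
Proof.
suff H x y : is_perron_eigenvalue A x -> is_perron_eigenvalue A y -> x <= y.
  by move=> Ar As; apply/eqP; rewrite eq_le !H.
move=> [Ax _] [_ /(_ (real_complex R x))].
have -> : eigenvalue (map_mx (real_complex R) A) (real_complex R x).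
  by rewrite eigenvalue_map.
move=> /(_ isT) Hxy; rewrite -lecR; apply: le_trans Hxy.
by rewrite normc_def/= lecR expr0n addr0 sqrtr_sqr ler_norm.
Qed.

(** For a complex eigenvector [w], let [q] be the greatest ratio [|w| / u], attained at [k]. The
    triangle inequality and [|w| <= q u] give [|z| |w_k| <= q (u A)_k = r |w_k|], where [|w_k|] is
    positive. *)
Lemma perron_of_pos_eigenvector A u r : (forall i j, 0 <= A i j) ->
  (0 < m)%N -> (forall j, 0 < u 0 j) -> u *m A = r *: u ->
  perron_eigenvalue A = r.
Proof.
move=> A0 m0 u0 uA; pose i0 := Ordinal m0.
suff Hr : is_perron_eigenvalue A r.
  rewrite /perron_eigenvalue; case: xgetP => [x _ Hx|/(_ r)//].
  exact: perron_unique Hx Hr.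
split.
  apply/eigenvalueP; exists u => //.
  by apply/eqP => /rowP/(_ i0); rewrite mxE => /eqP; rewrite gt_eqF.
move=> z /eigenvalueP[w wA wN0].
(* The modulus on [R[i]] has values in [R[i]]; its real part carries it to [R]. *)
have Nre (x : R[i]) : `|x| = real_complex R (complex.Re `|x|).
  by rewrite normc_def.
pose p i := complex.Re `|w 0 i|.
have [k _ kmax] := @arg_maxP _ _ _ i0 predT (fun i => p i / u 0 i) isT.
set q := p k / u 0 k in kmax.
have H i : p i <= q * u 0 i by rewrite -ler_pdivrMr//; exact: kmax.
have pk : p k = q * u 0 k by rewrite divfK// gt_eqF.
have p0 i : 0 <= p i by rewrite -lecR -Nre normr_ge0.
have pk0 : 0 < p k.
  have [i wi] : exists i, w 0 i != 0.
    apply/not_existsP => H0; case/negP: wN0; apply/eqP/rowP => i.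
    by rewrite mxE; have /negP/negPn/eqP := H0 i.
  have pi : 0 < p i by rewrite -ltcR -Nre normr_gt0.
  have : 0 < q by rewrite -(@pmulr_lgt0 _ (u 0 i))// (lt_le_trans pi).
  by rewrite pk => q0; rewrite mulr_gt0.
rewrite Nre lecR -(@ler_pM2r _ (p k))//.
have -> : complex.Re `|z| * p k = complex.Re `|z * w 0 k|.
  by rewrite normrM (Nre z) (Nre (w 0 k)) -rmorphM.
have /rowP/(_ k) := wA; rewrite [in RHS]mxE => <-.
apply: (@le_trans _ _ (\sum_i p i * A i k)).
  rewrite -lecR -Nre mxE rmorph_sum/=.
  apply: le_trans (ler_norm_sum _ _ _) _; apply: ler_sum => i _.
  rewrite normrM rmorphM/= -Nre mxE ler_wpM2l// normc_def/= expr0n addr0.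
  by rewrite sqrtr_sqr ger0_norm.
apply: (@le_trans _ _ (\sum_i q * u 0 i * A i k)).
  by apply: ler_sum => i _; rewrite ler_wpM2r.
have /rowP/(_ k) := uA; rewrite !mxE pk mulrCA => <-.
by rewrite mulr_sumr; apply: ler_sum => i _; rewrite mulrA.
Qed.

(* Multiplying [1^T (lam I - A) = (lam - 1) 1^T] by the adjugate. *)
Lemma char_stochastic A i0 (lam : R) : col_stochastic A ->
  \det (lam%:M - A) = (lam - 1) * \sum_j cofactor (lam%:M - A) i0 j.
Proof.
move=> As.
have H : const_mx 1 *m (lam%:M - A) = (lam - 1) *: const_mx 1 :> 'rV[R]_m.
  by rewrite mulmxBr (ones_mul As) mul_mx_scalar scalerBl scale1r.
have := congr1 (fun v : 'rV[R]_m => (v *m \adj (lam%:M - A)) 0 i0) H.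
rewrite -mulmxA mul_mx_adj mul_mx_scalar -scalemxAl !mxE mulr1 => ->.
by congr (_ * _); apply: eq_bigr => j _; rewrite !mxE mul1r.
Qed.

(** Expansion along row [i0], the row that its own cofactors do not see. *)
Lemma sum_cofactor A i0 :
  \sum_j cofactor (1%:M - A) i0 j = \det (ones_row A i0).
Proof.
rewrite (expand_det_row _ i0); apply: eq_bigr => j _.
rewrite mxE eqxx mul1r /cofactor; congr (_ * \det _).
by apply/matrixP => i k; rewrite !mxE [lift i0 i == i0]eq_sym (negbTE (neq_lift _ _)).
Qed.

(** As [1%:M - A] is singular, every row of its adjugate is fixed by [A], hence constant; some
    cofactor is nonzero because those of row [i0] add up to [\det (ones_row A i0)]. Rescaled, such a
    row stays positive under small perturbations, which later supplies positive eigenvectors. *)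
Lemma adj_const_row A : (0 < m)%N -> col_stochastic A -> mx_irreducible A ->
  exists i c, c != 0 /\ forall j, (\adj (1%:M - A)) i j = c.
Proof.
move=> m0 As Ai; pose i0 := Ordinal m0.
have := det_ones_row i0 As Ai; rewrite -sum_cofactor => S0.
have [j jN0] : exists j, cofactor (1%:M - A) i0 j != 0.
  apply/not_existsP => H0; case/negP: S0; apply/eqP/big1 => j _.
  by have /negP/negPn/eqP := H0 j.
exists j, (cofactor (1%:M - A) i0 j); split=> // k.
have d0 : \det (1%:M - A) = 0 by rewrite (char_stochastic i0)// subrr mul0r.
have ha : row j (\adj (1%:M - A)) *m A = row j (\adj (1%:M - A)).
  apply/eqP; rewrite -subr_eq0 -oppr_eq0 opprB -{1}[row _ _]mulmx1 -mulmxBr.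
  by rewrite -row_mul mul_adj_mx d0 -scalemx1 scale0r row0.
have := superharmonic_const (b := row j (\adj (1%:M - A))) As Ai.
move=> /(_ _ k i0); rewrite !mxE; apply=> l.
by rewrite ha.
Qed.

End LinearAlgebra.

(** * The implicit function theorem in the plane *)

Section ImplicitFunction.
Context {R : realType}.

Lemma mean_value (f df : R -> R) (a b : R) :
  (forall x : R, `|x - a| <= `|b - a| -> is_derive x 1 f (df x)) ->
  exists2 c : R, `|c - a| <= `|b - a| & f b - f a = df c * (b - a).
Proof.
have MV x y : x <= y -> (forall z : R, x <= z <= y -> is_derive z 1 f (df z)) ->
    exists2 c, x <= c <= y & f y - f x = df c * (y - x).
  move=> xy fdf.
  have cf : {within `[x, y], continuous f}.
    apply: derivable_within_continuous => z; rewrite in_itv/= => /fdf.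
    by case.
  have fdf' z : z \in `]x, y[%R -> is_derive z 1 f (df z).
    by rewrite in_itv/= => /andP[/ltW xz /ltW zy]; apply: fdf; rewrite xz.
  by have [c] := MVT_segment xy fdf' cf; rewrite in_itv/=; exists c.
move=> fdf; have [ab|/ltW ba] := leP a b.
  have [|c /andP[ac cb] E] := MV _ _ ab.
    move=> z /andP[az zb]; apply: fdf.
    by rewrite !ger0_norm ?subr_ge0// lerD2r.
  by exists c => //; rewrite !ger0_norm ?subr_ge0// lerD2r.
have [|c /andP[bc ca] E] := MV _ _ ba.
  move=> z /andP[bz za]; apply: fdf.
  by rewrite !ler0_norm ?subr_le0// lerN2 lerD2r.
exists c; first by rewrite !ler0_norm ?subr_le0// lerN2 lerD2r.
by rewrite -opprB E -mulrN opprB.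
Qed.

Lemma continuous2P (F : R -> R -> R) (x y e : R) :
  continuous (fun z : R * R => F z.1 z.2) -> 0 < e ->
  exists2 d : R, 0 < d & forall x' y', `|x' - x| < d -> `|y' - y| < d ->
    `|F x' y' - F x y| < e.
Proof.
move=> cF e0; have /cvgrPdist_lt/(_ e e0) := cF (x, y).
rewrite -[nbhs _]/(nbhs (x, y)) => /nbhs_ballP[d d0 H]; exists d => // x' y' xx yy.
rewrite distrC; apply: (H (x', y')).
by split; rewrite /ball/= distrC.
Qed.

(** [F2] is positive near [(0, y0)], so each [F x] increases there and changes sign between [y0 - e]
    and [y0 + e]. The intermediate value theorem gives the root [l x], monotonicity its uniqueness
    and continuity, the mean value theorem its derivative. *)
Lemma implicit_function_pos (F F1 F2 : R -> R -> R) (y0 : R) :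
  (forall x y : R, is_derive x 1 (F^~ y) (F1 x y)) ->
  (forall x y : R, is_derive y 1 (F x) (F2 x y)) ->
  continuous (fun z : R * R => F2 z.1 z.2) ->
  F 0 y0 = 0 -> 0 < F2 0 y0 ->
  exists (l : R -> R) (r : R), [/\ 0 < r, l 0 = y0 &
    forall x, `|x| < r -> [/\ F x (l x) = 0, 0 < F2 x (l x) &
      is_derive x 1 l (- F1 x (l x) / F2 x (l x))]].
Proof.
move=> dF1 dF2 cF2 F0 F20.
have [d d0 Hd] := continuous2P 0 y0 cF2 F20.
have Fpos x y : `|x| < d -> `|y - y0| < d -> 0 < F2 x y.
  move=> xd yd; have := Hd x y; rewrite subr0 => /(_ xd yd).
  by rewrite ltr_norml => /andP[+ _]; lra.
have Finc x y y' : `|x| < d -> `|y - y0| < d -> `|y' - y0| < d -> y < y' ->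
    F x y < F x y'.
  move=> xd yd yd' yy'.
  have cf : continuous (F x).
    move=> z; apply/differentiable_continuous/derivable1_diffP.
    by case: (dF2 x z).
  have [c] := MVT yy' (fun z _ => dF2 x z) (continuous_subspaceT cf).
  rewrite in_itv/= => /andP[yc cy] E; rewrite -subr_gt0 E mulr_gt0 ?subr_gt0//.
  apply: Fpos => //; move: yd yd'; rewrite !ltr_norml; lra.
have cont1 (y x : R) : {for x, continuous (F^~ y)}.
  by apply/differentiable_continuous/derivable1_diffP; case: (dF1 x y).
have cont1P (x y e : R) : 0 < e -> exists2 r : R, 0 < r & forall x', `|x' - x| < r ->
    `|F x' y - F x y| < e.
  move=> e0; have /cvgrPdist_lt/(_ e e0)/nbhs_ballP[r r0 H] := cont1 y x.
  by exists r => // x' xx'; rewrite distrC; apply: H; rewrite /ball/= distrC.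
pose e := d / 2.
have e0 : 0 < e by rewrite divr_gt0.
have ed : e < d by rewrite /e; lra.
have Fm : F 0 (y0 - e) < 0.
  rewrite -[ltRHS]F0; apply: Finc; rewrite ?normr0 ?subrr ?normr0//; last by lra.
  by rewrite addrAC subrr add0r normrN gtr0_norm.
have Fp : 0 < F 0 (y0 + e).
  rewrite -[ltLHS]F0; apply: Finc; rewrite ?normr0 ?subrr ?normr0//; last by lra.
  by rewrite addrAC subrr add0r gtr0_norm.
have [r1 r10 Hr1] := cont1P 0 (y0 - e) (- F 0 (y0 - e)) ltac:(lra).
have [r2 r20 Hr2] := cont1P 0 (y0 + e) (F 0 (y0 + e)) Fp.
pose r := Num.min d (Num.min r1 r2).
have r0 : 0 < r by rewrite !lt_min d0 r10.
(* The bound on [x] is placed inside the existential so that [choice] yields a total function. *)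
have root x : exists y, `|x| < r -> `|y - y0| < e /\ F x y = 0.
  have [xr|_] := ltP `|x| r; last by exists 0.
  have := xr; rewrite !lt_min => /and3P[xd x1 x2].
  have m : F x (y0 - e) < 0.
    by have := Hr1 x; rewrite subr0 => /(_ x1); rewrite ltr_norml; lra.
  have p : 0 < F x (y0 + e).
    by have := Hr2 x; rewrite subr0 => /(_ x2); rewrite ltr_norml; lra.
  have [|||c] := @IVT R (F x) (y0 - e) (y0 + e) 0.
  - lra.
  - apply: continuous_subspaceT => z.
    apply/differentiable_continuous/derivable1_diffP.
    by case: (dF2 x z).
  - by rewrite ge_min le_max (ltW m) (ltW p) orbT.
  - rewrite in_itv/= => /andP[c1 c2] Fc; exists c => _; split => //.
    have ? : y0 - e < c.
      rewrite lt_neqAle c1 andbT; apply/eqP => E.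
      by move: m; rewrite E Fc ltxx.
    have ? : c < y0 + e.
      rewrite lt_neqAle c2 andbT; apply/eqP => E.
      by move: p; rewrite -E Fc ltxx.
    by rewrite ltr_norml; lra.
have [l Hl] := choice root.
have uniq x y y' : `|x| < r -> `|y - y0| < d -> `|y' - y0| < d -> F x y = 0 ->
    F x y' = 0 -> y = y'.
  rewrite lt_min => /andP[xd _] yd yd' Fy Fy'.
  have [yy'|yy'|//] := ltgtP y y'.
    by have := Finc x y y' xd yd yd' yy'; rewrite Fy Fy' ltxx.
  by have := Finc x y' y xd yd' yd yy'; rewrite Fy Fy' ltxx.
have l0 : l 0 = y0.
  have [|? ?] := Hl 0; first by rewrite normr0.
  by apply: (uniq 0); rewrite ?normr0 ?subrr ?normr0//; apply: lt_trans ed.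
exists l, r; split=> // x xr.
have [lx Fl] := Hl x xr.
have xd : `|x| < d by move: xr; rewrite lt_min => /andP[].
have F2l : 0 < F2 x (l x) by apply: Fpos => //; apply: lt_trans ed.
split=> //.
(* Continuity of [l]: for [x'] close to [x], [F x'] keeps opposite signs at [l x - k'] and
   [l x + k'], which traps its root. The choice of [k'] keeps both points within [d] of [y0]. *)
have lcont (k : R) : 0 < k -> exists2 s : R, 0 < s & forall x', `|x' - x| < s ->
    `|x'| < r /\ `|l x' - l x| < k.
  move=> k0; pose k' := Num.min k (e - `|l x - y0|).
  have k'0 : 0 < k' by rewrite lt_min k0 subr_gt0.
  have k'k : k' <= k by rewrite ge_min lexx.
  have k'e : k' <= e - `|l x - y0| by rewrite ge_min lexx orbT.
  have B y : `|y - l x| <= k' -> `|y - y0| < d.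
    move=> ylx; apply: le_lt_trans ed.
    by rewrite (le_trans (ler_distD (l x) _ _))//; lra.
  have Bp : `|l x + k' - y0| < d.
    by apply: B; rewrite addrAC subrr add0r ger0_norm// ltW.
  have Bm : `|l x - k' - y0| < d.
    by apply: B; rewrite addrAC subrr add0r normrN ger0_norm// ltW.
  have Bl : `|l x - y0| < d by apply: lt_trans ed.
  have m : F x (l x - k') < 0 by rewrite -[ltRHS]Fl; apply: Finc => //; lra.
  have p : 0 < F x (l x + k') by rewrite -[ltLHS]Fl; apply: Finc => //; lra.
  have [s1 s10 Hs1] := cont1P x (l x - k') (- F x (l x - k')) ltac:(lra).
  have [s2 s20 Hs2] := cont1P x (l x + k') (F x (l x + k')) p.
  exists (Num.min (r - `|x|) (Num.min s1 s2)).
    by rewrite !lt_min subr_gt0 xr s10.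
  move=> x'; rewrite 2!lt_min => /and3P[x'r x's1 x's2].
  have x'r' : `|x'| < r.
    by rewrite -(subrK x x') (le_lt_trans (ler_normD _ _))//; lra.
  have x'd : `|x'| < d by move: x'r'; rewrite lt_min => /andP[].
  split; [exact: x'r' |apply: lt_le_trans k'k].
  have [lx' Fl'] := Hl x' x'r'.
  have lx'd : `|l x' - y0| < d by apply: lt_trans ed.
  have m' : F x' (l x - k') < 0 by have := Hs1 x' x's1; rewrite ltr_norml; lra.
  have p' : 0 < F x' (l x + k') by have := Hs2 x' x's2; rewrite ltr_norml; lra.
  rewrite ltr_norml; apply/andP; split; rewrite ltNge; apply/negP => H.
    have : l x' <= l x - k' by lra.
    rewrite le_eqVlt => /orP[/eqP E|E]; first by move: m'; rewrite -E Fl' ltxx.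
    by have := Finc x' _ _ x'd lx'd Bm E; rewrite Fl' ltNge ltW.
  have : l x + k' <= l x' by lra.
  rewrite le_eqVlt => /orP[/eqP E|E]; first by move: p'; rewrite E Fl' ltxx.
  by have := Finc x' _ _ x'd Bp lx'd E; rewrite Fl' ltNge ltW.
(* For small [h], [F] vanishes at [(x, l x)] and at [(h + x, l (h + x))], so this identity makes the
   increment of [l] equal to minus the increment of [F] in its first variable, divided by [F2] at
   the intermediate point [xi h]. *)
have /choice[xi Hxi] (h : R) : exists c, `|c - l x| <= `|l (h + x) - l x|
    /\ F (h + x) (l (h + x)) - F (h + x) (l x) =
       F2 (h + x) c * (l (h + x) - l x).
  by have [c ? ?] := @mean_value (F (h + x)) (F2 (h + x)) (l x) (l (h + x))
    (fun z _ => dF2 (h + x) z); exists c.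
have cE : F2 (h + x) (xi h) @[h --> 0^'] --> F2 x (l x).
  apply/cvgrPdist_lt => k k0.
  have [s s0 Hs] := continuous2P x (l x) cF2 k0.
  have [q q0 Hq] := lcont s s0.
  have sq : 0 < Num.min s q by rewrite lt_min s0.
  have := @dnbhs0_lt R R _ sq.
  apply: filterS => h; rewrite lt_min => /andP[hs hq].
  rewrite distrC; apply: Hs; first by rewrite addrK.
  apply: le_lt_trans (Hxi h).1 _; apply: (Hq _ _).2.
  by rewrite addrK.
have cD : h^-1 *: (F (h + x) (l x) - F x (l x)) @[h --> 0^'] --> F1 x (l x).
  have [D <-] := dF1 x (l x).
  move: D; rewrite /derivable /derive => /cvg_ex[L HL].
  have HL' : h^-1 *: (F (h + x) (l x) - F x (l x)) @[h --> 0^'] --> L.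
    apply: cvg_trans HL; apply: near_eq_cvg; near=> h.
    by rewrite /= !scaler1.
  have : lim ((h^-1 *: ((F^~ (l x) \o shift x) (h *: 1) - F x (l x))) @[h --> 0^']) = L.
    exact: cvg_lim HL.
  by move=> ->.
have cQ : h^-1 *: (l (h + x) - l x) @[h --> 0^'] --> - F1 x (l x) / F2 x (l x).
  have : - (h^-1 *: (F (h + x) (l x) - F x (l x))) / F2 (h + x) (xi h) @[h --> 0^']
      --> - F1 x (l x) / F2 x (l x).
    by apply: cvgM; [exact: cvgN | apply: cvgV => //; rewrite gt_eqF].
  move=> cH; apply: cvg_trans cH; apply: near_eq_cvg.
  have [q q0 Hq] := lcont 1 ltr01.
  have N1 := @dnbhs0_lt R R _ q0.
  have N2 : \forall h \near 0^', 0 < F2 (h + x) (xi h) := cvgr_gt _ cE _ F2l.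
  near=> h.
  have hq : `|h| < q by near: h.
  have F2h : 0 < F2 (h + x) (xi h) by near: h; exact: N2.
  have [|hxr _] := Hq (h + x); first by rewrite addrK.
  have [_ E0] := Hl (h + x) hxr; have [_] := Hxi h.
  rewrite E0 sub0r Fl subr0 /= => E.
  by rewrite -scalerN E -scalerAl mulrAC mulfV ?gt_eqF// mul1r.
have cQ' : h^-1 *: ((l \o shift x) (h *: 1) - l x) @[h --> 0^'] --> - F1 x (l x) / F2 x (l x).
  by apply: cvg_trans cQ; apply: near_eq_cvg; near=> h; rewrite /= scaler1.
split; first exact: cvgP cQ'.
exact: cvg_lim cQ'.
Unshelve. all: by end_near.
Qed.

End ImplicitFunction.

(** * Exponential polynomials and the regularity of their implicit roots *)

Section ExpPolynomials.
Context {R : realType}.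

(* Functions of (theta, lambda) that are closed under partial derivatives and
   contain the entries of [lambda%:M - tilted matrix]. *)
Inductive exp_poly : (R -> R -> R) -> Prop :=
| exp_poly_cst c : exp_poly (fun _ _ => c)
| exp_poly_var : exp_poly (fun _ y => y)
| exp_poly_exp a : exp_poly (fun x _ => expR (x * a))
| exp_polyD F G : exp_poly F -> exp_poly G -> exp_poly (fun x y => F x y + G x y)
| exp_polyM F G : exp_poly F -> exp_poly G -> exp_poly (fun x y => F x y * G x y).

Lemma exp_poly_eq F G : exp_poly F -> (forall x y, F x y = G x y) -> exp_poly G.
Proof. by move=> eF FG; rewrite -(_ : F = G)//; do 2![apply/funext => ?]. Qed.

Lemma exp_polyN F : exp_poly F -> exp_poly (fun x y => - F x y).
Proof.
move=> eF; apply: exp_poly_eq (exp_polyM (exp_poly_cst (-1)) eF) _ => x y.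
by rewrite mulN1r.
Qed.

Lemma exp_poly_sum (I : Type) (s : seq I) (P : pred I) (F : I -> R -> R -> R) :
  (forall i, exp_poly (F i)) ->
  exp_poly (fun x y => \sum_(i <- s | P i) F i x y).
Proof.
move=> eF; elim: s => [|i s IH].
  by apply: exp_poly_eq (exp_poly_cst 0) _ => x y; rewrite big_nil.
case Pi: (P i); last first.
  by apply: exp_poly_eq IH _ => x y; rewrite big_cons Pi.
by apply: exp_poly_eq (exp_polyD (eF i) IH) _ => x y; rewrite big_cons Pi.
Qed.

Lemma exp_poly_prod (I : Type) (s : seq I) (P : pred I) (F : I -> R -> R -> R) :
  (forall i, exp_poly (F i)) ->
  exp_poly (fun x y => \prod_(i <- s | P i) F i x y).
Proof.
move=> eF; elim: s => [|i s IH].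
  by apply: exp_poly_eq (exp_poly_cst 1) _ => x y; rewrite big_nil.
case Pi: (P i); last first.
  by apply: exp_poly_eq IH _ => x y; rewrite big_cons Pi.
by apply: exp_poly_eq (exp_polyM (eF i) IH) _ => x y; rewrite big_cons Pi.
Qed.

Lemma exp_poly_det m (M : R -> R -> 'M[R]_m) :
  (forall i j, exp_poly (fun x y => M x y i j)) ->
  exp_poly (fun x y => \det (M x y)).
Proof.
move=> eM; apply: exp_poly_sum => s; apply: exp_polyM.
  exact: exp_poly_cst.
by apply: exp_poly_prod => i; exact: eM.
Qed.

Lemma exp_poly_cofactor m (M : R -> R -> 'M[R]_m) i j :
  (forall i j, exp_poly (fun x y => M x y i j)) ->
  exp_poly (fun x y => cofactor (M x y) i j).
Proof.
move=> eM; apply: exp_polyM; first exact: exp_poly_cst.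
apply: exp_poly_det => k l.
by apply: exp_poly_eq (eM _ _) _ => x y; rewrite !mxE.
Qed.

Lemma exp_poly_continuous F : exp_poly F ->
  continuous (fun z : R * R => F z.1 z.2).
Proof.
elim=> [c|||{}F G _ IF _ IG|{}F G _ IF _ IG] => [z|z|a z|z|z].
- exact: cvg_cst.
- exact: cvg_snd.
- apply: (@continuous_comp _ _ _ (fun z : R * R => z.1 * a) expR); last first.
    exact: continuous_expR.
  by apply: cvgM; [exact: cvg_fst|exact: cvg_cst].
- exact: cvgD (IF z) (IG z).
- exact: cvgM (IF z) (IG z).
Qed.

Lemma exp_poly_partial1 F : exp_poly F -> exists2 F1, exp_poly F1 &
  forall x y : R, is_derive x 1 (F^~ y) (F1 x y).
Proof.
elim=> [c||a|{}F G eF [F1 eF1 dF] eG [G1 eG1 dG]|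
        {}F G eF [F1 eF1 dF] eG [G1 eG1 dG]].
- exists (fun _ _ => 0); first exact: exp_poly_cst.
  by move=> x y; exact: is_derive_cst.
- exists (fun _ _ => 0); first exact: exp_poly_cst.
  by move=> x y; exact: is_derive_cst.
- exists (fun x _ => expR (x * a) * a).
    by apply: exp_polyM; [exact: exp_poly_exp|exact: exp_poly_cst].
  move=> x y; apply: (@is_derive1_comp _ expR (fun x : R => x * a)).
  have := @is_deriveM _ _ _ _ x 1 _ _ (is_derive_id x (1 : R)) (is_derive_cst a x (1 : R)).
  move/is_derive_eq; apply.
  by rewrite scaler0 add0r [LHS]mulr1.
- exists (fun x y => F1 x y + G1 x y); first exact: exp_polyD.
  by move=> x y; exact: is_deriveD.
- exists (fun x y => F x y * G1 x y + G x y * F1 x y).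
    by apply: exp_polyD; exact: exp_polyM.
  by move=> x y; exact: is_deriveM.
Qed.

Lemma exp_poly_partial2 F : exp_poly F -> exists2 F2, exp_poly F2 &
  forall x y : R, is_derive y 1 (F x) (F2 x y).
Proof.
elim=> [c||a|{}F G eF [F1 eF1 dF] eG [G1 eG1 dG]|
        {}F G eF [F1 eF1 dF] eG [G1 eG1 dG]].
- exists (fun _ _ => 0); first exact: exp_poly_cst.
  by move=> x y; exact: is_derive_cst.
- exists (fun _ _ => 1); first exact: exp_poly_cst.
  by move=> x y; exact: is_derive_id.
- exists (fun _ _ => 0); first exact: exp_poly_cst.
  by move=> x y; exact: is_derive_cst.
- exists (fun x y => F1 x y + G1 x y); first exact: exp_polyD.
  by move=> x y; exact: is_deriveD.
- exists (fun x y => F x y * G1 x y + G x y * F1 x y).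
    by apply: exp_polyD; exact: exp_polyM.
  by move=> x y; exact: is_deriveM.
Qed.

(** Induction on [exp_poly] takes the place of a chain rule in two variables. *)
Lemma exp_poly_derivable_along F (l : R -> R) (x : R) : exp_poly F ->
  derivable l x 1 -> derivable (fun z => F z (l z)) x 1.
Proof.
move=> eF dl; elim: eF => [c||a|{}F G _ IF _ IG|{}F G _ IF _ IG].
- exact: derivable_cst.
- exact: dl.
- have [F1 _ dF] := exp_poly_partial1 (exp_poly_exp a).
  by have [] := dF x 0.
- exact: derivableD.
- exact: derivableM.
Qed.

(** Near 0 the derivative of [l] is [- F1 / F2] along the graph, and this is derivable at 0 because
    [F1] and [F2] are again exponential polynomials. If [c] is negative, [- F] replaces [F]. *)
Lemma implicit_function F (y0 c : R) : exp_poly F -> F 0 y0 = 0 ->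
  is_derive y0 1 (F 0) c -> c != 0 ->
  exists l : R -> R, [/\ l 0 = y0, \forall x \near 0, F x (l x) = 0,
    \forall x \near 0, derivable l x 1 & derivable (derive1 l) 0 1].
Proof.
wlog c0 : F c / 0 < c.
  move=> H eF F0 dF cN0; have := cN0; rewrite neq_lt => /orP[cn|cp]; last first.
    exact: (H F c).
  have NF0 : - F 0 y0 = 0 by rewrite F0 oppr0.
  have [||l [l0 Fl dl ddl]] := H (fun x y => - F x y) (- c) _ (exp_polyN eF)
    NF0 (is_deriveN dF).
  - by rewrite oppr_gt0.
  - by rewrite oppr_eq0.
  exists l; split => //; apply: filterS Fl => x /eqP.
  by rewrite oppr_eq0 => /eqP.
move=> eF F0 dFc _.
have [F1 eF1 dF1] := exp_poly_partial1 eF.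
have [F2 eF2 dF2] := exp_poly_partial2 eF.
have F20 : 0 < F2 0 y0.
  have [_ <-] := dF2 0 y0; by have [_ ->] := dFc.
have [l [r [r0 l0 Hl]]] :=
  implicit_function_pos dF1 dF2 (exp_poly_continuous eF2) F0 F20.
have nr : \forall x \near (0 : R), `|x| < r.
  by apply/nbhs_ballP; exists r => // x; rewrite /ball/= sub0r normrN.
exists l; split => //.
- by apply: filterS nr => x /Hl[].
- by apply: filterS nr => x /Hl[_ _ []].
- have [_ F2l [dl _]] := Hl 0 ltac:(by rewrite normr0).
  apply: (@near_eq_derivable _ _ _ (fun x => - F1 x (l x) / F2 x (l x))).
    apply: filterS nr => x /Hl[_ _ [_ E]].
    by rewrite derive1E E.
  apply: derivableM; last apply: derivableV; rewrite ?gt_eqF//.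
    exact: (exp_poly_derivable_along (exp_polyN eF1)).
  exact: exp_poly_derivable_along.
Qed.

End ExpPolynomials.

(** * Second-order expansions at 0 *)

Section Taylor.
Context {R : realType}.

Lemma near0P (P : R -> Prop) : (\forall x \near (0 : R), P x) ->
  exists2 d : R, 0 < d & forall x, `|x| < d -> P x.
Proof.
move=> /nbhs_ballP[d d0 Hd]; exists d => // x xd.
by apply: Hd; rewrite /ball/= sub0r normrN.
Qed.

(** Mean value theorem for [f] minus its linear and quadratic terms: the derivative
    [f1 z - f1 0 - f2 * z] is [o(z)] because [f1] is derivable at 0. *)
Lemma taylor2 (f f1 : R -> R) (f2 k : R) :
  (\forall x \near (0 : R), is_derive x (1 : R) f (f1 x)) -> is_derive (0 : R) 1 f1 f2 -> 0 < k ->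
  \forall x \near (0 : R), `|f x - f 0 - f1 0 * x - f2 / 2 * x ^+ 2| <= k * x ^+ 2.
Proof.
move=> df df1 k0.
have H1 : \forall x \near (0 : R), `|f1 x - f1 0 - f2 * x| <= k * `|x|.
  have [D <-] := df1.
  move: D; rewrite /derivable /derive => D.
  move/cvgrPdist_le : D => /(_ k k0) D.
  have {}D : \forall x \near (0 : R), x != 0 ->
    `|'D_1 f1 0 - x^-1 * (f1 x - f1 0)| <= k.
    move: D; rewrite near_withinE; apply: filterS => x H x0.
    by have := H x0; rewrite /= addr0 [x *: 1]mulr1.
  apply: filterS D => x; have [-> _|x0 /(_ isT) H] := eqVneq x 0.
    by rewrite subrr mulr0 subrr !normr0 mulr0.
  have -> : f1 x - f1 0 - 'D_1 f1 0 * x =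
      - ('D_1 f1 0 - x^-1 * (f1 x - f1 0)) * x by field.
  by rewrite normrM normrN ler_wpM2r.
have [d1 d10 {}df] := near0P df; have [d2 d20 {}H1] := near0P H1.
apply/nbhs_ballP; exists (Num.min d1 d2); first by rewrite /= lt_min d10.
move=> x; rewrite /ball/= sub0r normrN lt_min => /andP[xd1 xd2].
pose g z := f z - (f1 0 * z + f2 / 2 * (z * z)).
have dg (z : R) : `|z - 0| <= `|x - 0| -> is_derive z 1 g (f1 z - f1 0 - f2 * z).
  rewrite !subr0 => zx.
  have dz := df z (le_lt_trans zx xd1).
  have dq := is_deriveB dz (is_deriveD
    (@is_deriveM _ _ _ _ z 1 _ _ (is_derive_cst (f1 0) z (1 : R)) (is_derive_id z (1 : R)))
    (@is_deriveM _ _ _ _ z 1 _ _ (is_derive_cst (f2 / 2) z (1 : R))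
      (@is_deriveM _ _ _ _ z 1 _ _ (is_derive_id z (1 : R)) (is_derive_id z (1 : R))))).
  apply: is_derive_eq dq _.
  by rewrite /cst/= !scaler0 !addr0 /GRing.scale/= !mulr1; field.
have [c cx] := mean_value dg; rewrite /g !subr0 in cx *.
move=> E.
have -> : f x - f 0 - f1 0 * x - f2 / 2 * x ^+ 2 = (f1 c - f1 0 - f2 * c) * x.
  by rewrite -E; ring.
rewrite normrM -(real_normK (num_real x)) expr2 mulrA ler_wpM2r//.
by rewrite (le_trans (H1 c (le_lt_trans cx xd2)))// ler_wpM2l// ltW.
Qed.

(** Uniqueness of second-order expansions, used to read off the derivatives of [phi]. *)
Lemma quadratic_small (a b : R) :
  (forall k, 0 < k -> \forall x \near (0 : R), `|a * x + b * x ^+ 2| <= k * x ^+ 2) ->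
  a = 0 /\ b = 0.
Proof.
move=> H.
have a0 : a = 0.
  apply: contrapT => /eqP aN0.
  have [d d0 Hd] := near0P (H 1 ltr01).
  have na : 0 < `|a| by rewrite normr_gt0.
  have nb : 0 < 1 + `|b| by rewrite ltr_wpDr.
  (* So small that [x + |b| x <= |a| / 2], against [|a| <= |a + b x| + |b x| <= x + |b| x]. *)
  pose x := Num.min (d / 2) (`|a| / (2 * (1 + `|b|))).
  have x0 : 0 < x by rewrite lt_min !divr_gt0// mulr_gt0.
  have xd : x <= d / 2 by rewrite ge_min lexx.
  have xa : x * (2 * (1 + `|b|)) <= `|a|.
    by rewrite -ler_pdivlMr ?mulr_gt0// ge_min lexx orbT.
  have := Hd x; rewrite gtr0_norm// => /(_ ltac:(lra)).
  have -> : a * x + b * x ^+ 2 = (a + b * x) * x by ring.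
  rewrite normrM (gtr0_norm x0) mul1r expr2 ler_pM2r// => H1.
  have : `|a| <= `|a + b * x| + `|b * x|.
    by rewrite -[leLHS](congr1 _ (addrK (b * x) a)) ler_normB.
  rewrite normrM (gtr0_norm x0); nra.
split=> //; apply: contrapT => /eqP bN0.
have nb : 0 < `|b| by rewrite normr_gt0.
have [d d0 Hd] := near0P (H (`|b| / 2) ltac:(lra)).
have := Hd (d / 2); rewrite gtr0_norm; last by lra.
move=> /(_ ltac:(lra)); rewrite a0 mul0r add0r normrM.
rewrite [`|_ ^+ 2|]ger0_norm ?sqr_ge0// ler_pM2r ?exprn_gt0//; lra.
Qed.

Lemma expR_quadratic (a b k : R) : 0 < k -> \forall x \near (0 : R),
  `|expR (x * a + x ^+ 2 * b) - 1 - a * x - (b + a ^+ 2 / 2) * x ^+ 2|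
    <= k * x ^+ 2.
Proof.
move=> k0.
pose q (x : R) := x * a + x ^+ 2 * b.
have dq (x : R) : is_derive x 1 q (a + 2 * x * b).
  have dq := is_deriveD
    (@is_deriveM _ _ _ _ x 1 _ _ (is_derive_id x (1 : R)) (is_derive_cst a x (1 : R)))
    (@is_deriveM _ _ _ _ x 1 _ _
      (@is_deriveM _ _ _ _ x 1 _ _ (is_derive_id x (1 : R)) (is_derive_id x (1 : R)))
      (is_derive_cst b x (1 : R))).
  apply: is_derive_eq dq _.
  rewrite /cst/= !scaler0 !add0r /GRing.scale/= !mulr1; ring.
have de (x : R) : is_derive x 1 (expR \o q) (expR (q x) * (a + 2 * x * b)).
  exact: is_derive1_comp.
have dde : is_derive (0 : R) (1 : R) (fun x : R => expR (q x) * (a + 2 * x * b)) (2 * b + a ^+ 2).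
  have dl := is_deriveD (is_derive_cst a (0 : R) (1 : R))
    (@is_deriveM _ _ _ _ (0 : R) (1 : R) _ _ 
      (@is_deriveM _ _ _ _ (0 : R) (1 : R) _ _ (is_derive_cst (2 : R) (0 : R) (1 : R)) (is_derive_id (0 : R) (1 : R)))
      (is_derive_cst b (0 : R) (1 : R))).
  have {}dl : is_derive (0 : R) (1 : R) (fun x => a + 2 * x * b) (2 * b).
    apply: is_derive_eq dl _.
    by rewrite /cst/= /GRing.scale/= !(mulr0, addr0, add0r) mulr1 mulrC.
  have dm := @is_deriveM _ _ _ _ (0 : R) (1 : R) _ _ (de 0) dl.
  apply: is_derive_eq dm _.
  rewrite /= /cst/= /GRing.scale/= /q !expr2 !(mul0r, mulr0, addr0, add0r) expR0.
  ring.
have nde : \forall x \near (0 : R), is_derive x (1 : R) (expR \o q)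
    (expR (q x) * (a + 2 * x * b)) by apply: filterE => x; exact: de.
apply: filterS (taylor2 nde dde k0) => x; congr (`| _ | <= _).
by rewrite /= /q !expr2 !(mul0r, mulr0, addr0) expR0; field.
Qed.

Lemma expR_quadratic_cvg (a b : R) :
  expR (t * a + t ^+ 2 * b) @[t --> (0 : R)] --> (1 : R).
Proof.
have : expR (t * a + t ^+ 2 * b) @[t --> (0 : R)] --> expR (0 * a + 0 ^+ 2 * b).
  apply: continuous_cvg; first exact: continuous_expR.
  apply: cvgD; first by apply: (cvgM (f := id)); [exact: cvg_id|exact: cvg_cst].
  apply: (cvgM (f := fun t : R => t ^+ 2)); last exact: cvg_cst.
  exact: exprn_continuous.
by rewrite expr2 !mul0r addr0 expR0.
Qed.

End Taylor.

(** * Poisson equations and approximate eigenvectors of the tilted kernel *)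

Section Chain.
Context {R : realType} {X : finType}.
Implicit Types (W K g : X -> X -> R) (b v : X -> R).

Lemma sum_enum_val (f : X -> R) : \sum_x f x = \sum_(i < #|X|) f (enum_val i).
Proof.
rewrite (reindex (enum_val (A := X)))//.
by exists enum_rank => i _; rewrite ?enum_valK ?enum_rankK.
Qed.

(** Functions on [X] are row vectors multiplied from the left, because it is the columns of a
    transition matrix that sum to 1. *)
Definition row_of b : 'rV[R]_#|X| := \row_i b (enum_val i).

Lemma row_ofK (u : 'rV[R]_#|X|) : u = row_of (fun x => u 0 (enum_rank x)).
Proof. by apply/rowP => i; rewrite mxE enum_valK. Qed.

Lemma row_of_mul b K :
  row_of b *m mx_of K = row_of (fun y => \sum_x b x * K x y).
Proof.
apply/rowP => j; rewrite !mxE sum_enum_val; apply: eq_bigr => i _.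
by rewrite !mxE.
Qed.

Lemma mx_of_stochastic W : transition_matrix W -> col_stochastic (mx_of W).
Proof.
move=> hW; split=> [i j|j]; first by rewrite mxE; have [] := hW (enum_val j).
have [_ <-] := hW (enum_val j); rewrite sum_enum_val.
by apply: eq_bigr => i _; rewrite mxE.
Qed.

Lemma mx_of_irreducible W : irreducible W -> mx_irreducible (mx_of W).
Proof.
move=> hW i j; have [n [_]] := hW (enum_val i) (enum_val j).
by rewrite /pow_entry !enum_valK => ?; exists n.
Qed.

Lemma superharmonic_constX W b : transition_matrix W -> irreducible W ->
  (forall y, \sum_x b x * W x y <= b y) -> forall x y, b x = b y.
Proof.
move=> /mx_of_stochastic sW /mx_of_irreducible iW hb x y.
have := @superharmonic_const _ _ _ (row_of b) sW iW _ (enum_rank x) (enum_rank y).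
by rewrite !mxE !enum_rankK; apply => j; rewrite row_of_mul !mxE.
Qed.

Lemma poisson_equation W v : transition_matrix W -> irreducible W ->
  exists b s, forall y, \sum_x b x * W x y - b y + v y = s.
Proof.
move=> /mx_of_stochastic sW /mx_of_irreducible iW.
have [u [s H]] := poisson_mx (row_of v) sW iW.
exists (fun x => u 0 (enum_rank x)), s => y.
rewrite -(H (enum_rank y)) [in RHS](row_ofK u) row_of_mul !mxE enum_rankK.
by [].
Qed.

Section Variance.
Variables (W g : X -> X -> R) (hW : transition_matrix W) (iW : irreducible W).

(** The first Poisson equation centres [g]; the second makes the conditional variance of the centred
    [G] constant up to the corrector [b]. Were [s2 <= 0], [b] would be superharmonic, hence
    constant, so [G] would have zero conditional variance and vanish wherever [W] is positive,
    contradicting the assumption on [g]. *)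
Lemma variance_data :
  ~ (exists (f : X -> R) (c : R),
      forall x y : X, 0 < W x y -> g x y = f x - f y + c) ->
  exists (a b : X -> R) (eta s2 : R), [/\ 0 < s2,
   forall y, \sum_x W x y * (g x y - eta + a x - a y) = 0 &
   forall y, \sum_x W x y * ((g x y - eta + a x - a y) ^+ 2 + b x - b y) = s2].
Proof.
move=> hg.
have split3 (f p : X -> R) c y : \sum_x W x y * (f x + p x - c) =
    \sum_x W x y * f x + \sum_x p x * W x y - c.
  have [_ W1] := hW y.
  rewrite -[c in RHS]mulr1 -W1 mulr_sumr -big_split/= -sumrB.
  by apply: eq_bigr => x _; ring.
have [a [eta Ha]] := poisson_equation (fun y => \sum_x W x y * g x y) hW iW.
pose G x y := g x y - eta + a x - a y.
have [b [s2 Hb]] := poisson_equation (fun y => \sum_x W x y * G x y ^+ 2) hW iW.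
have Ga y : \sum_x W x y * G x y = 0.
  rewrite (split3 (fun x => g x y - eta) a).
  have -> : \sum_x W x y * (g x y - eta) = \sum_x W x y * g x y - eta.
    rewrite -[eta in RHS]mulr1 -(hW y).2 mulr_sumr -sumrB.
    by apply: eq_bigr => x _; ring.
  by rewrite -(Ha y); ring.
have Gb y : \sum_x W x y * (G x y ^+ 2 + b x - b y) = s2.
  by rewrite (split3 (fun x => G x y ^+ 2)) -(Hb y); ring.
exists a, b, eta, s2; split => //.
rewrite ltNge; apply/negP => s20; apply: hg.
exists (fun x => - a x), eta => x y Wxy.
have V0 z : 0 <= \sum_x W x z * G x z ^+ 2.
  by apply: sumr_ge0 => w _; rewrite mulr_ge0 ?sqr_ge0//; have [] := hW z.
have bc : forall x y, b x = b y.
  apply: (superharmonic_constX hW iW) => z.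
  by have := Hb z; have := V0 z; lra.
have V y' : \sum_x W x y' * G x y' ^+ 2 = s2.
  have [_ W1] := hW y'; rewrite -(Hb y').
  have -> : \sum_x b x * W x y' = b y'.
    by rewrite -[RHS]mulr1 -W1 mulr_sumr; apply: eq_bigr => z _; rewrite (bc z y').
  by rewrite subrr add0r.
have : \sum_x W x y * G x y ^+ 2 = 0.
  by apply/eqP; rewrite eq_le V0 V s20.
move=> /eqP; rewrite psumr_eq0; last first.
  by move=> w _; rewrite mulr_ge0 ?sqr_ge0//; have [] := hW y.
move=> /allP/(_ x (mem_index_enum x)); rewrite /= mulf_eq0 gt_eqF//= sqrf_eq0.
by rewrite /G => /eqP; lra.
Qed.

(** Take [v = exp (t a + t^2 b / 2)]. Once [exp (t eta + t^2 s / 2) v y] is factored out of the sum,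
    the equations for [a] and [b] leave [1 + (s2 - s) / 2 t^2 + o(t^2)], which is compared with 1
    for [s = s2 + k] and [s = s2 - k]. *)
Lemma approx_eigenvector (a b : X -> R) (eta s2 k : R) : 0 < k ->
  (forall y, \sum_x W x y * (g x y - eta + a x - a y) = 0) ->
  (forall y, \sum_x W x y * ((g x y - eta + a x - a y) ^+ 2 + b x - b y) = s2) ->
  \forall t \near (0 : R), exists v : X -> R,
    [/\ forall x, 2^-1 <= v x <= 2,
     forall y, \sum_x v x * tilted W g t x y <=
       expR (t * eta + t ^+ 2 * ((s2 + k) / 2)) * v y &
     forall y, expR (t * eta + t ^+ 2 * ((s2 - k) / 2)) * v y <=
       \sum_x v x * tilted W g t x y].
Proof.
move=> k0 Ha Hb.
pose G x y := g x y - eta + a x - a y.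
pose B s x y := (b x - b y - s) / 2.
(* The main term differs from 1 by [k / 2 t^2], so an error of [k / 4 t^2] leaves it on the same
   side of 1. *)
have k4 : 0 < k / 4 by lra.
have S s t y : \sum_x W x y * (1 + G x y * t
      + (B s x y + G x y ^+ 2 / 2) * t ^+ 2) = 1 + (s2 - s) / 2 * t ^+ 2.
  have [_ W1] := hW y.
  transitivity ((1 - s / 2 * t ^+ 2) * (\sum_x W x y) +
      t * (\sum_x W x y * G x y) +
      t ^+ 2 / 2 * (\sum_x W x y * (G x y ^+ 2 + b x - b y))).
    rewrite !mulr_sumr -!big_split/=; apply: eq_bigr => x _.
    by rewrite /B; field.
  by rewrite W1 Ha Hb; field.
have N s : \forall t \near (0 : R), forall y,
    `|\sum_x W x y * expR (t * G x y + t ^+ 2 * B s x y)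
      - (1 + (s2 - s) / 2 * t ^+ 2)| <= k / 4 * t ^+ 2.
  have : \forall t \near (0 : R), forall x y,
      `|expR (t * G x y + t ^+ 2 * B s x y) - 1 - G x y * t
        - (B s x y + G x y ^+ 2 / 2) * t ^+ 2| <= k / 4 * t ^+ 2.
    exact: filter_forall _ (fun x => filter_forall _ (fun y =>
      expR_quadratic (G x y) (B s x y) k4)).
  apply: filterS => t M y; rewrite -(S s t y) -sumrB.
  have -> : k / 4 * t ^+ 2 = \sum_x W x y * (k / 4 * t ^+ 2).
    by rewrite -mulr_suml (hW y).2 mul1r.
  apply: le_trans (ler_norm_sum _ _ _) _; apply: ler_sum => x _.
  rewrite -mulrBr normrM ger0_norm ?(hW y).1// ler_wpM2l ?(hW y).1//.
  by rewrite !opprD !addrA.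
have Nv : \forall t \near (0 : R), forall x,
    2^-1 <= expR (t * a x + t ^+ 2 * (b x / 2)) <= 2.
  suff Nvx x : \forall t \near (0 : R),
      2^-1 <= expR (t * a x + t ^+ 2 * (b x / 2)) <= 2.
    exact: filter_forall _ Nvx.
  have C := expR_quadratic_cvg (a x) (b x / 2).
  have N1 := cvgr_ge _ C (2^-1) ltac:(lra).
  have N2 := cvgr_le _ C 2 ltac:(lra).
  by apply: filterS2 N1 N2 => t ? ?; apply/andP.
have E s t y : \sum_x expR (t * a x + t ^+ 2 * (b x / 2)) * tilted W g t x y =
    expR (t * eta + t ^+ 2 * (s / 2)) * expR (t * a y + t ^+ 2 * (b y / 2)) *
    \sum_x W x y * expR (t * G x y + t ^+ 2 * B s x y).
  rewrite mulr_sumr; apply: eq_bigr => x _.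
  rewrite /tilted mulrCA [RHS]mulrCA -!expRD; congr (_ * expR _).
  by rewrite /G /B; field.
apply: filterS3 Nv (N (s2 + k)) (N (s2 - k)) => t Nvt Np Nm.
have t2 := sqr_ge0 t.
exists (fun x => expR (t * a x + t ^+ 2 * (b x / 2))); split => // y.
- rewrite (E (s2 + k)) -[leRHS]mulr1 ler_wpM2l ?mulr_ge0 ?expR_ge0//.
  by have := Np y; rewrite ler_norml => /andP[_]; nra.
- rewrite (E (s2 - k)) -[leLHS]mulr1 ler_wpM2l ?mulr_ge0 ?expR_ge0//.
  by have := Nm y; rewrite ler_norml => /andP[+ _]; nra.
Qed.

End Variance.

End Chain.

(** * Regularity and expansion of the Perron eigenvalue *)

Section PerronRegularity.
Context {R : realType} {X : finType}.
Variables (W g : X -> X -> R) (hW : transition_matrix W) (iW : irreducible W).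
Hypothesis X0 : (0 < #|X|)%N.

Let A t := mx_of (tilted W g t).

Lemma tilted_ge0 t x y : 0 <= tilted W g t x y.
Proof. by rewrite mulr_ge0 ?expR_ge0//; have [] := hW y. Qed.

Lemma tilted0 : tilted W g 0 = W.
Proof. by apply/funext => x; apply/funext => y; rewrite /tilted mul0r expR0 mulr1. Qed.

(** At [t = 0] the root 1 of the characteristic polynomial is simple, so the implicit function
    theorem continues it to [l]. A row of the adjugate at [l t] gives a left eigenvector; near 0 it
    keeps one sign, since at 0 it is a nonzero constant. *)
Lemma perron_smooth : exists l : R -> R, [/\
  \forall t \near (0 : R), 0 < l t /\ exists2 u : 'rV[R]_#|X|,
     forall j, 0 < u 0 j & u *m A t = l t *: u,
  \forall t \near (0 : R), derivable l t 1 & derivable (derive1 l) 0 1].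
Proof.
have sA := mx_of_stochastic hW; have iA := mx_of_irreducible iW.
pose M t lam : 'M[R]_#|X| := lam%:M - A t.
have eM i j : exp_poly (fun t lam => M t lam i j).
  pose w := W (enum_val i) (enum_val j).
  apply: (@exp_poly_eq _ (fun t lam => lam * (i == j)%:R +
      - (w * expR (t * g (enum_val i) (enum_val j))))) => [|t lam].
    apply: exp_polyD; last apply: exp_polyN; apply: exp_polyM.
    - exact: exp_poly_var.
    - exact: exp_poly_cst.
    - exact: exp_poly_cst.
    - exact: exp_poly_exp.
  by rewrite !mxE mulr_natr.
have M0 lam : M 0 lam = lam%:M - mx_of W by rewrite /M /A tilted0.
pose i0 := Ordinal X0.
(* At [t = 0] this is the characteristic polynomial divided by [lam - 1], so [D 0 1] is its
   derivative at the root 1. *)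
pose D t lam := \sum_j cofactor (M t lam) i0 j.
have eD : exp_poly D by apply: exp_poly_sum => j; exact: exp_poly_cofactor.
have D1 : D 0 1 != 0 by rewrite /D M0 sum_cofactor det_ones_row.
have eF := exp_poly_det eM.
have F0 lam : \det (M 0 lam) = (lam - 1) * D 0 lam.
  by rewrite /D M0 (char_stochastic i0).
have dF : is_derive (1 : R) (1 : R) (fun lam => \det (M 0 lam)) (D 0 1).
  have -> : (fun lam => \det (M 0 lam)) = (fun lam => (lam - 1) * D 0 lam).
    by apply/funext => lam; rewrite F0.
  have [D2 _ dD] := exp_poly_partial2 eD.
  have ds := is_deriveB (is_derive_id (1 : R) (1 : R)) (is_derive_cst (1 : R) (1 : R) (1 : R)).
  have dm := @is_deriveM _ _ _ _ (1 : R) (1 : R) _ _ ds (dD 0 1).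
  apply: is_derive_eq dm _.
  by rewrite /= /GRing.scale/= subr0 mulr1 [X in X * _]subrr mul0r add0r.
have [|l [l0 Fl dl ddl]] := implicit_function eF _ dF D1.
  by rewrite F0 subrr mul0r.
exists l; split => //.
have cl : l t @[t --> (0 : R)] --> (1 : R).
  rewrite -l0; apply: differentiable_continuous; apply/derivable1_diffP.
  exact: nbhs_singleton dl.
have [i [c [cN0 Hc]]] := adj_const_row X0 sA iA.
have pos j : \forall t \near (0 : R), 0 < c^-1 * cofactor (M t (l t)) j i.
  have ec := exp_poly_continuous (exp_polyM (exp_poly_cst c^-1) (exp_poly_cofactor j i eM)).
  have C : c^-1 * cofactor (M t (l t)) j i @[t --> (0 : R)] --> (1 : R).
    have <- : c^-1 * cofactor (M 0 1) j i = 1.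
      by have := Hc j; rewrite mxE M0 => ->; rewrite mulVf.
    exact: (cvg_comp (fun t : R => (t, l t)) _
      (cvg_pair (@cvg_id _ (nbhs (0 : R))) cl) (ec (0, 1))).
  exact: cvgr_gt C _ ltr01.
have lpos : \forall t \near (0 : R), 0 < l t.
  exact: cvgr_gt cl _ ltr01.
have posA : \forall t \near (0 : R), forall j, 0 < c^-1 * cofactor (M t (l t)) j i.
  exact: filter_forall _ pos.
apply: filterS3 posA lpos Fl => t post lt Ft; split => //.
exists (c^-1 *: row i (\adj (M t (l t)))) => [j|].
  by rewrite !mxE; exact: post.
have : row i (\adj (M t (l t))) *m M t (l t) = 0.
  by rewrite -row_mul mul_adj_mx Ft -scalemx1 scale0r row0.
rewrite /M mulmxBr mul_mx_scalar => /eqP; rewrite subr_eq0 => /eqP E.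
by rewrite -scalemxAl -/(M t (l t)) -E !scalerA mulrC.
Qed.

Lemma phi_expansion (a b : X -> R) (eta s2 k : R) : 0 < k ->
  (forall y, \sum_x W x y * (g x y - eta + a x - a y) = 0) ->
  (forall y, \sum_x W x y * ((g x y - eta + a x - a y) ^+ 2 + b x - b y) = s2) ->
  \forall t \near (0 : R), `|phi W g t - eta * t - s2 / 2 * t ^+ 2| <= k * t ^+ 2.
Proof.
move=> k0 Ha Hb.
have [l [Hl _ _]] := perron_smooth.
(* Doubled because the exponents of [approx_eigenvector] carry [k / 2]. *)
have k2 : 0 < 2 * k by lra.
have Hv := approx_eigenvector hW k2 Ha Hb.
apply: filterS2 Hl Hv => t [lt [u u0 uA]] [v [v2 vle vge]].
have A0 i j : 0 <= A t i j by rewrite mxE tilted_ge0.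
have v0 j : 0 < row_of v 0 j.
  by rewrite mxE; have /andP[+ _] := v2 (enum_val j); lra.
have P : phi W g t = ln (l t) by rewrite /phi (perron_of_pos_eigenvector A0 X0 u0 uA).
have L1 : l t <= expR (t * eta + t ^+ 2 * ((s2 + 2 * k) / 2)).
  apply: (collatz_le A0 X0 u0 v0 uA) => j.
  by rewrite row_of_mul !mxE.
have L2 : expR (t * eta + t ^+ 2 * ((s2 - 2 * k) / 2)) <= l t.
  apply: (collatz_ge A0 X0 u0 v0 uA) => j.
  by rewrite row_of_mul !mxE.
move: L1 L2; rewrite -(lnK (x := l t)) ?posrE// !ler_expR -P ler_norml.
by move=> L1 L2; apply/andP; split; lra.
Qed.

(** Near 0 [phi] is [ln l], so it has a Taylor expansion of order two; by uniqueness its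
    coefficients are those of [phi_expansion]. *)
Lemma phi_derivatives (a b : X -> R) (eta s2 : R) :
  (forall y, \sum_x W x y * (g x y - eta + a x - a y) = 0) ->
  (forall y, \sum_x W x y * ((g x y - eta + a x - a y) ^+ 2 + b x - b y) = s2) ->
  derive1 (phi W g) 0 = eta /\ derive1n 2 (phi W g) 0 = s2.
Proof.
move=> Ha Hb.
have [l [Hl dl ddl]] := perron_smooth.
have P : \forall t \near (0 : R), ln (l t) = phi W g t.
  apply: filterS Hl => t [lt [u u0 uA]].
  have A0 i j : 0 <= A t i j by rewrite mxE tilted_ge0.
  by rewrite /phi (perron_of_pos_eigenvector A0 X0 u0 uA).
have dphi : \forall t \near (0 : R),
    is_derive t (1 : R) (phi W g) ((l t)^-1 * derive1 l t).
  (* To carry derivatives over, the equality must hold around each [t] near 0 and not only at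
     [t]. *)
  have P' : \forall t \near (0 : R), \forall s \near t, ln (l s) = phi W g s.
    exact: near_join.
  apply: filterS3 P' Hl dl => t Pt [lt _] dlt.
  apply: (near_eq_is_derive Pt).
  have dl1 : is_derive t (1 : R) l (derive1 l t).
    by rewrite derive1E; exact: derivableP.
  exact: is_derive1_comp (is_derive1_ln lt) dl1.
have d1 : \forall t \near (0 : R), (l t)^-1 * derive1 l t = derive1 (phi W g) t.
  by apply: filterS dphi => t [_ <-]; rewrite derive1E.
have dphi1 : \forall t \near (0 : R),
    is_derive t (1 : R) (phi W g) (derive1 (phi W g) t).
  by apply: filterS2 dphi d1 => t + <-.
have ddphi : is_derive (0 : R) (1 : R) (derive1 (phi W g)) (derive1n 2 (phi W g) 0).
  rewrite /= derive1E; apply: derivableP; apply: (near_eq_derivable d1).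
  apply: derivableM ddl; apply: derivableV; last exact: nbhs_singleton dl.
  by have [? _] := nbhs_singleton Hl; rewrite gt_eqF.
have phi0 : phi W g 0 = 0.
  have := nbhs_singleton (phi_expansion ltr01 Ha Hb).
  by rewrite expr2 !mulr0 !subr0 normr_le0 => /eqP.
have T k := @taylor2 _ _ _ _ k dphi1 ddphi; rewrite phi0 in T.
set f1 := derive1 _ 0 in T *; set f2 := derive1n _ _ 0 in T *.
clearbody f1 f2; clear dphi dphi1 ddphi d1.
suff [E1 E2] : f1 - eta = 0 /\ f2 / 2 - s2 / 2 = 0 by split; lra.
apply: quadratic_small => k k0; have k2 : 0 < k / 2 by lra.
apply: filterS2 (phi_expansion k2 Ha Hb) (T _ k2) => t.
rewrite subr0 !ler_norml.
move: (phi _ _ _) => f /andP[? ?] /andP[? ?].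
by apply/andP; split; lra.
Qed.

End PerronRegularity.

(** * Path sums and moment generating functions *)

Section PathSums.
Context {R : realType} {X : finType}.
Implicit Types (p v : X -> R) (K : X -> X -> R).

Definition path_cons n (z : X * {ffun 'I_n.+1 -> X}) : {ffun 'I_n.+2 -> X} :=
  [ffun i => if unlift ord0 i is Some j then z.2 j else z.1].

(** Summing out the first state moves the initial weight one step along the kernel; the inductions
    on [n] therefore run over all [p]. *)
Lemma path_sumS n p K :
  \sum_(x : {ffun 'I_n.+2 -> X}) path_prob p K x =
  \sum_(x : {ffun 'I_n.+1 -> X}) path_prob (fun x1 => \sum_y p y * K x1 y) K x.
Proof.
rewrite (reindex (@path_cons n)); last first.
  exists (fun x : {ffun 'I_n.+2 -> X} => (x ord0, [ffun j => x (lift ord0 j)])).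
    move=> [y x] _; congr (_, _); first by rewrite ffunE unlift_none.
    by apply/ffunP => j; rewrite !ffunE liftK.
  by move=> x _; apply/ffunP => i; rewrite !ffunE; case: unliftP => [j|] ->;
    rewrite ?ffunE.
rewrite -(pair_bigA _ (fun y x => path_prob p K (path_cons (y, x))))/=.
rewrite exchange_big; apply: eq_bigr => x _; rewrite /path_prob mulr_suml.
apply: eq_bigr => y _; rewrite big_ord_recl mulrA.
have E0 : path_cons (y, x) ord0 = y by rewrite ffunE unlift_none.
have E1 j : path_cons (y, x) (lift ord0 j) = x j by rewrite ffunE liftK.
have -> : widen_ord (leqnSn n.+1) ord0 = ord0 by exact: val_inj.
rewrite E0 E1; congr (_ * _); apply: eq_bigr => i _.
have -> : widen_ord (leqnSn n.+1) (lift ord0 i) =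
  lift ord0 (widen_ord (leqnSn n) i) by exact: val_inj.
by rewrite !E1.
Qed.

Lemma path_sum0 p K :
  \sum_(x : {ffun 'I_1 -> X}) path_prob p K x = \sum_y p y.
Proof.
rewrite (reindex (fun y : X => [ffun _ : 'I_1 => y])).
  by apply: eq_bigr => y _; rewrite /path_prob big_ord0 mulr1 ffunE.
exists (fun x : {ffun 'I_1 -> X} => x ord0) => [y _|x _]; first by rewrite ffunE.
by apply/ffunP => i; rewrite ffunE; congr (x _); apply/val_inj; case: i => -[].
Qed.

(** Each step multiplies the [v]-weighted mass by at most [rho]; at the last state [c <= v] returns
    to the plain mass. *)
Lemma path_sum_le n p K v (c rho : R) : (forall x, 0 <= p x) ->
  (forall x y, 0 <= K x y) -> 0 <= rho -> (forall x, c <= v x) ->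
  (forall y, \sum_x v x * K x y <= rho * v y) ->
  c * (\sum_(x : {ffun 'I_n.+1 -> X}) path_prob p K x)
    <= rho ^+ n * (\sum_y p y * v y).
Proof.
move=> p0 K0 rho0 cv vK; elim: n p p0 => [|n IH] p p0.
  rewrite path_sum0 mul1r mulr_sumr; apply: ler_sum => y _.
  by rewrite mulrC ler_wpM2l.
rewrite path_sumS.
have q0 x : 0 <= \sum_y p y * K x y by apply: sumr_ge0 => y _; rewrite mulr_ge0.
apply: le_trans (IH _ q0) _.
rewrite exprSr -mulrA ler_wpM2l ?exprn_ge0// mulr_sumr.
under eq_bigr do rewrite mulr_suml.
rewrite exchange_big/=; apply: ler_sum => y _.
rewrite mulrCA; apply: le_trans (ler_wpM2l (p0 y) (vK y)).
by rewrite mulr_sumr; apply: ler_sum => x _; rewrite mulrAC mulrA.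
Qed.

Lemma path_sum_ge n p K v (c rho : R) : (forall x, 0 <= p x) ->
  (forall x y, 0 <= K x y) -> 0 <= rho -> (forall x, v x <= c) ->
  (forall y, rho * v y <= \sum_x v x * K x y) ->
  rho ^+ n * (\sum_y p y * v y) <=
    c * (\sum_(x : {ffun 'I_n.+1 -> X}) path_prob p K x).
Proof.
move=> p0 K0 rho0 cv vK; elim: n p p0 => [|n IH] p p0.
  rewrite path_sum0 mul1r mulr_sumr; apply: ler_sum => y _.
  by rewrite [leRHS]mulrC ler_wpM2l.
rewrite path_sumS.
have q0 x : 0 <= \sum_y p y * K x y by apply: sumr_ge0 => y _; rewrite mulr_ge0.
apply: le_trans (IH _ q0).
rewrite exprSr -mulrA ler_wpM2l ?exprn_ge0// mulr_sumr.
under [leRHS]eq_bigr do rewrite mulr_suml.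
rewrite exchange_big/=; apply: ler_sum => y _.
rewrite mulrCA; apply: le_trans (ler_wpM2l (p0 y) (vK y)) _.
by rewrite mulr_sumr; apply: ler_sum => x _; rewrite mulrAC mulrA.
Qed.

Lemma path_prob_tilted (P0 h : X -> R) (W g : X -> X -> R) (t : R) n
    (x : {ffun 'I_n.+1 -> X}) :
  path_prob P0 W x * expR (t * g_tilde g h x) =
  path_prob (fun y => P0 y * expR (t * h y)) (tilted W g t) x.
Proof.
rewrite /path_prob /g_tilde /tilted big_split/= mulrDr expRD mulr_sumr expR_sum.
by rewrite -!mulrA; congr (_ * _); rewrite [RHS]mulrCA; congr (_ * _);
  rewrite mulrC.
Qed.

(** One neighbourhood of 0 serves all [n], which later allows slopes that shrink with [n]. The
    factor 8 is 2 from [v] at the last state times 4 from [exp (t h) v] at the first. *)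
Lemma mgf_bounds (W g : X -> X -> R) (P0 h a b : X -> R) (eta s2 k : R) :
  transition_matrix W -> distribution_on P0 -> 0 < k ->
  (forall y, \sum_x W x y * (g x y - eta + a x - a y) = 0) ->
  (forall y, \sum_x W x y * ((g x y - eta + a x - a y) ^+ 2 + b x - b y) = s2) ->
  \forall t \near (0 : R), forall n,
    8^-1 * expR (n%:R * (t ^+ 2 * ((s2 - k) / 2))) <=
    \sum_(x : {ffun 'I_n.+1 -> X})
       path_prob P0 W x * expR (t * (g_tilde g h x - n%:R * eta)) <=
    8 * expR (n%:R * (t ^+ 2 * ((s2 + k) / 2))).
Proof.
move=> hW [P00 P01] k0 Ha Hb.
have Nh : \forall t \near (0 : R), forall x, 2^-1 <= expR (t * h x) <= 2.
  suff Nhx x : \forall t \near (0 : R), 2^-1 <= expR (t * h x) <= 2.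
    exact: filter_forall _ Nhx.
  have C := expR_quadratic_cvg (h x) 0.
  have N1 := cvgr_ge _ C (2^-1) ltac:(lra).
  have N2 := cvgr_le _ C 2 ltac:(lra).
  by apply: filterS2 N1 N2 => t; rewrite mulr0 addr0 => ? ?; apply/andP.
apply: filterS2 Nh (approx_eigenvector hW k0 Ha Hb) => t Nh [v [v2 vle vge]] n.
set p := fun y => P0 y * expR (t * h y).
have p0 y : 0 <= p y by rewrite mulr_ge0 ?expR_ge0.
have K0 x y : 0 <= tilted W g t x y by rewrite mulr_ge0 ?expR_ge0//; have [] := hW y.
have -> : \sum_(x : {ffun 'I_n.+1 -> X})
       path_prob P0 W x * expR (t * (g_tilde g h x - n%:R * eta)) =
    expR (- (n%:R * (t * eta))) *
    \sum_(x : {ffun 'I_n.+1 -> X}) path_prob p (tilted W g t) x.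
  rewrite mulr_sumr; apply: eq_bigr => x _.
  by rewrite -path_prob_tilted [RHS]mulrCA -expRD; congr (_ * expR _); ring.
set S := \sum_(x : {ffun _ -> _}) _.
have [Sle Sge] : 2^-1 * S <= expR (t * eta + t ^+ 2 * ((s2 + k) / 2)) ^+ n * 4 /\
    expR (t * eta + t ^+ 2 * ((s2 - k) / 2)) ^+ n * 4^-1 <= 2 * S.
  have B y : P0 y * 4^-1 <= p y * v y <= P0 y * 4.
    have /andP[h1 h2] := Nh y; have /andP[v1 v3] := v2 y.
    by rewrite /p -mulrA; apply/andP; split; apply: ler_wpM2l => //; nra.
  have Pc c : c = \sum_y P0 y * c by rewrite -mulr_suml P01 mul1r.
  split.
    apply: le_trans (path_sum_le n p0 K0 (expR_ge0 _) _ vle) _.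
      by move=> x; have /andP[] := v2 x.
    rewrite ler_wpM2l ?exprn_ge0 ?expR_ge0// [leRHS]Pc.
    by apply: ler_sum => y _; have /andP[] := B y.
  apply: le_trans (path_sum_ge n p0 K0 (expR_ge0 _) _ vge); last first.
    by move=> x; have /andP[] := v2 x.
  rewrite ler_wpM2l ?exprn_ge0 ?expR_ge0// [leLHS]Pc.
  by apply: ler_sum => y _; have /andP[] := B y.
have E z : expR (n%:R * z) = expR (- (n%:R * (t * eta))) * expR (t * eta + z) ^+ n.
  by rewrite -expRM_natl -expRD; congr expR; ring.
rewrite !E; set e0 := expR (- _).
have e00 : 0 <= e0 by exact: expR_ge0.
by apply/andP; split; nra.
Qed.

End PathSums.

(** * A Gartner-Ellis theorem with quadratic rate at speed [a n] *)

Section QuadraticDeviations.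
Context {R : realType}.
Variables (T : nat -> finType) (p Z : forall n, T n -> R) (a : nat -> R) (s2 : R).
Arguments p {n}. Arguments Z {n}.
Hypotheses (p0 : forall n (x : T n), 0 <= p x) (a_oo : a n @[n --> \oo] --> +oo).
Hypothesis (s20 : 0 < s2).

Let mgf s n := \sum_(x : T n) p x * expR (a n * (s * Z x)).

(** This amounts to [ln (mgf s n) / a n] tending to [s2 s^2 / 2]; [C] absorbs bounded factors. *)
Hypothesis mgfP : forall s k, 0 < k -> exists2 C, 0 < C & \forall n \near \oo,
  C^-1 * expR (a n * (s ^+ 2 * ((s2 - k) / 2))) <= mgf s n <=
  C * expR (a n * (s ^+ 2 * ((s2 + k) / 2))).

Let tail d n := \sum_(x : T n | d <= Z x) p x.

Lemma a_ge0 : \forall n \near \oo, 0 <= a n.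
Proof. by near=> n; apply/ltW; near: n; apply: cvgry_gt.
Unshelve. all: by end_near. Qed.

(** Chernoff's inequality at the slope [s = d / s2], which maximises [s d - s2 s^2 / 2]. *)
Lemma tail_upper d e : 0 < d -> 0 < e -> exists2 C, 0 < C &
  \forall n \near \oo, tail d n <= C * expR (a n * (e - d ^+ 2 / (2 * s2))).
Proof.
move=> d0 e0; pose s := d / s2.
have sd : s2 * s = d by rewrite /s; field; rewrite gt_eqF.
have s0 : 0 < s by rewrite divr_gt0.
(* Chosen so that [s^2 k / 2 = e]. *)
pose k := 2 * e / s ^+ 2.
have k0 : 0 < k by rewrite !(divr_gt0, mulr_gt0) ?exprn_gt0.
have [C C0 HC] := mgfP s k0; exists C => //.
apply: filterS2 HC a_ge0 => n /andP[_ M] an0.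
rewrite -(@ler_pM2r _ (expR (a n * (s * d)))) ?expR_gt0//.
rewrite -[leRHS]mulrA -expRD.
have -> : a n * (e - d ^+ 2 / (2 * s2)) + a n * (s * d) =
    a n * (s ^+ 2 * ((s2 + k) / 2)).
  by rewrite /k -sd; field; rewrite !gt_eqF.
apply: le_trans M; rewrite /tail /mgf mulr_suml.
rewrite [leRHS](bigID (fun x => d <= Z x))/= -[leLHS]addr0; apply: lerD.
  apply: ler_sum => x dx; rewrite ler_wpM2l// ler_expR.
  by rewrite ler_wpM2l// ler_wpM2l// ltW.
by apply: sumr_ge0 => x _; rewrite mulr_ge0 ?expR_ge0.
Qed.

(* Exponential change of measure at slope [s]: outside of [d <= Z < d'], where
   the tilted measure is centred, the tilted mass is controlled by the moment
   generating functions at the neighbouring slopes [s + u] and [s - u]. *)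
Lemma mgf_split s u n : 0 <= a n -> 0 <= s -> 0 <= u ->
  mgf s n <= expR (a n * (s2 * s * (s + u))) * tail (s2 * (s - u)) n
    + expR (- (a n * (s2 * u * (s + u)))) * mgf (s + u) n
    + expR (a n * (s2 * u * (s - u))) * mgf (s - u) n.
Proof.
move=> an0 s0 u0.
rewrite /tail big_mkcond/= !mulr_sumr -!big_split/=; apply: ler_sum => x _.
set z := Z x.
have H1 : 0 <= p x * expR (- (a n * (s2 * u * (s + u))) + a n * ((s + u) * z)).
  by rewrite mulr_ge0 ?expR_ge0.
have H2 : 0 <= p x * expR (a n * (s2 * u * (s - u)) + a n * ((s - u) * z)).
  by rewrite mulr_ge0 ?expR_ge0.
rewrite ![expR _ * (p x * _)]mulrCA -!expRD.
have [zlo|zlo] := leP (s2 * (s - u)) z; last first.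
  rewrite mulr0 add0r; apply: ler_wpDl => //.
  rewrite ler_wpM2l// ler_expR -mulrDr ler_wpM2l//.
  nra.
have [zhi|zhi] := leP z (s2 * (s + u)).
  rewrite -addrA; apply: ler_wpDr; first exact: addr_ge0.
  rewrite mulrC ler_wpM2r// ler_expR ler_wpM2l//.
  by rewrite [s2 * s]mulrC -mulrA ler_wpM2l.
rewrite addrAC; apply: ler_wpDl.
  by apply: addr_ge0 => //; rewrite mulr_ge0 ?expR_ge0.
rewrite ler_wpM2l// ler_expR -mulrN -mulrDr ler_wpM2l//.
nra.
Qed.

(** [mgf_split] is used at a slope [s] just above [d / s2]. Since [s2 (s + u)^2 / 2 - s2 u (s + u)]
    and [s2 (s - u)^2 / 2 + s2 u (s - u)] both equal [s2 (s^2 - u^2) / 2], the two outer terms are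
    exponentially smaller than [mgf s n], and the tail must account for the rest. *)
Lemma tail_lower d e : 0 < d -> 0 < e -> exists2 c, 0 < c &
  \forall n \near \oo, c * expR (- (a n * (d ^+ 2 / (2 * s2) + e))) <= tail d n.
Proof.
move=> d0 e0; pose s1 := d / s2.
have s10 : 0 < s1 by rewrite divr_gt0.
(* With [u <= 1], the exponent lost by moving the slope, [s2 (2 s1 u + 3 / 2 u^2)], is at most
   [e / 2]. *)
pose u := Num.min 1 (e / (2 * s2 * (2 * s1 + 3 / 2))).
have den0 : 0 < 2 * s2 * (2 * s1 + 3 / 2) by rewrite !mulr_gt0//; lra.
have u0 : 0 < u by rewrite lt_min ltr01 divr_gt0.
have u1 : u <= 1 by rewrite ge_min lexx.
have ue : u * (2 * s2 * (2 * s1 + 3 / 2)) <= e.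
  by rewrite -ler_pdivlMr// ge_min lexx orbT.
pose s := s1 + u.
have s0 : 0 < s by rewrite addr_gt0.
have ds : s2 * (s - u) = d by rewrite /s addrK /s1; field; rewrite gt_eqF.
pose Q := s ^+ 2 + (s + u) ^+ 2 + (s - u) ^+ 2.
have Q0 : 0 < Q.
  by rewrite /Q -addrA ltr_wpDr ?exprn_gt0// addr_ge0 ?sqr_ge0.
(* The bound by [e] keeps [k s^2 / 2] within the other half of [e]; the bound by [s2 u^2 / 2] still
   leaves the outer terms smaller by a factor [exp (- a n s2 u^2 / 4)]. *)
pose k := Num.min e (s2 * u ^+ 2 / 2) / Q.
have k0 : 0 < k by rewrite divr_gt0// lt_min e0 !(divr_gt0, mulr_gt0) ?exprn_gt0.
have kQ : k * Q = Num.min e (s2 * u ^+ 2 / 2) by rewrite divfK// gt_eqF.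
have kQe : k * Q <= e by rewrite kQ ge_min lexx.
have kQu : k * Q <= s2 * u ^+ 2 / 2 by rewrite kQ ge_min lexx orbT.
have kp : k * (s ^+ 2 + (s + u) ^+ 2) <= s2 * u ^+ 2 / 2.
  by apply: le_trans kQu; rewrite ler_wpM2l ?(ltW k0)// lerDl sqr_ge0.
have km : k * (s ^+ 2 + (s - u) ^+ 2) <= s2 * u ^+ 2 / 2.
  by apply: le_trans kQu; rewrite ler_wpM2l ?(ltW k0)// lerD2r lerDl sqr_ge0.
have [C C0 HC] := mgfP s k0.
have [Cp Cp0 HCp] := mgfP (s + u) k0.
have [Cm Cm0 HCm] := mgfP (s - u) k0.
exists (2^-1 * C^-1); first by rewrite mulr_gt0 ?invr_gt0.
(* Eventually the two outer terms together are at most half of the lower bound on [mgf s n]. *)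
have small : \forall n \near \oo, ln (2 * C * (Cp + Cm)) <= a n * (s2 * u ^+ 2 / 4).
  have v0 : 0 < s2 * u ^+ 2 / 4 by rewrite divr_gt0// mulr_gt0 ?exprn_gt0.
  near=> n.
  by rewrite -ler_pdivrMr//; near: n; apply: cvgry_ge.
apply: filterS3 (filterI HC HCp) HCm (filterI a_ge0 small) =>
  n [/andP[M _] /andP[_ Mp]] /andP[_ Mm] [an0 sm].
have := mgf_split an0 (ltW s0) (ltW u0); rewrite ds => split3.
set L := expR (a n * (s ^+ 2 * ((s2 - k) / 2))) in M.
have L0 : 0 < L by exact: expR_gt0.
have small2 : (Cp + Cm) * expR (- (a n * (s2 * u ^+ 2 / 4))) <= 2^-1 * C^-1.
  have Cpm : 0 < Cp + Cm by rewrite addr_gt0.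
  rewrite expRN ler_pdivrMr ?expR_gt0//.
  rewrite -ler_pdivrMl ?mulr_gt0 ?invr_gt0// -invfM invrK.
  by rewrite -[leLHS]lnK ?posrE ?mulr_gt0// ler_expR.
have Ep : expR (- (a n * (s2 * u * (s + u)))) * mgf (s + u) n <=
    Cp * (L * expR (- (a n * (s2 * u ^+ 2 / 4)))).
  apply: le_trans (ler_wpM2l (expR_ge0 _) Mp) _.
  rewrite mulrCA ler_wpM2l ?(ltW Cp0)// -!expRD ler_expR.
  rewrite -[- (a n * (s2 * u * _))]mulrN -[- (a n * (_ / 4))]mulrN.
  rewrite -!mulrDr ler_wpM2l//.
  by move: kp; lra.
have Em : expR (a n * (s2 * u * (s - u))) * mgf (s - u) n <=
    Cm * (L * expR (- (a n * (s2 * u ^+ 2 / 4)))).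
  apply: le_trans (ler_wpM2l (expR_ge0 _) Mm) _.
  rewrite mulrCA ler_wpM2l ?(ltW Cm0)// -!expRD ler_expR.
  rewrite -[- (a n * (_ / 4))]mulrN -!mulrDr ler_wpM2l//.
  by move: km; lra.
have T1 : 2^-1 * C^-1 * L <= expR (a n * (s2 * s * (s + u))) * tail d n.
  have : (Cp + Cm) * expR (- (a n * (s2 * u ^+ 2 / 4))) * L <= 2^-1 * C^-1 * L.
    by rewrite ler_pM2r.
  move: M split3 Ep Em; move: (C^-1) => C'.
  lra.
rewrite -(@ler_pM2l _ (expR (a n * (s2 * s * (s + u))))) ?expR_gt0//.
apply: le_trans T1; rewrite mulrCA ler_wpM2l//.
  by rewrite mulr_ge0// invr_ge0 ltW.
rewrite -expRD ler_expR -mulrN -mulrDr ler_wpM2l//.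
have -> : d ^+ 2 / (2 * s2) = s2 * s1 ^+ 2 / 2.
  by rewrite /s1; field; rewrite gt_eqF.
have : k * s ^+ 2 <= e.
  apply: le_trans kQe; rewrite ler_wpM2l ?(ltW k0)//.
  by rewrite /Q -addrA lerDl addr_ge0 ?sqr_ge0.
have : s2 * u ^+ 2 <= s2 * u by rewrite ler_wpM2l ?(ltW s20)// expr2 ler_piMl// ltW.
rewrite /s; move: ue; nra.
Unshelve. all: by end_near.
Qed.

Lemma quadratic_deviations d : 0 < d ->
  - (a n)^-1 * ln (tail d n) @[n --> \oo] --> d ^+ 2 / (2 * s2).
Proof.
move=> d0; apply/cvgrPdist_le => e e0.
have e2 : 0 < e / 2 by lra.
have [C C0 HC] := tail_upper d0 e2; have [c c0 Hc] := tail_lower d0 e2.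
near=> n.
have an0 : 0 < a n by near: n; apply: cvgry_gt.
have Hn : tail d n <= C * expR (a n * (e / 2 - d ^+ 2 / (2 * s2))).
  by near: n.
have Hn' : c * expR (- (a n * (d ^+ 2 / (2 * s2) + e / 2))) <= tail d n.
  by near: n.
have C1 : ln C <= a n * (e / 2) by rewrite -ler_pdivrMr//; near: n; apply: cvgry_ge.
have C2 : - ln c <= a n * (e / 2) by rewrite -ler_pdivrMr//; near: n; apply: cvgry_ge.
(* [ln] takes a default value off the positive reals; the lower bound excludes this case for large
   [n]. *)
have t0 : 0 < tail d n by apply: lt_le_trans Hn'; rewrite mulr_gt0 ?expR_gt0.
move: Hn Hn'.
rewrite -ler_ln ?posrE ?mulr_gt0 ?expR_gt0// lnM ?posrE ?expR_gt0// expRK => Hn.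
rewrite -ler_ln ?posrE ?mulr_gt0 ?expR_gt0// lnM ?posrE ?expR_gt0// expRK => Hn'.
set J := d ^+ 2 / (2 * s2) in Hn Hn' *.
rewrite -(@ler_pM2l _ (a n))// -[X in X * `|_|]gtr0_norm// -normrM mulrBr mulNr mulrN opprK mulVKf ?gt_eqF//.
by rewrite ler_norml; apply/andP; split; nra.
Unshelve. all: by end_near.
Qed.

End QuadraticDeviations.

(** * Moderate-deviation scaling and conclusion *)

Lemma cvgy_powR_nat (R : realType) (r : R) : 0 < r ->
  (n%:R : R) `^ r @[n --> \oo] --> +oo.
Proof.
move=> r0; apply/cvgryPge => A; pose B := Num.max A 1.
have B1 : 0 <= B by rewrite le_max ler01 orbT.
have /cvgryPge/(_ (B `^ r^-1)) N := cvgr_idn (R := R).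
apply: filterS N => n Bn; apply: (@le_trans _ _ B); first by rewrite le_max lexx.
have <- : (B `^ r^-1) `^ r = B by rewrite -powRrM mulVf ?gt_eqF// powRr1.
by apply: ge0_ler_powR; rewrite ?nnegrE ?powR_ge0 ?ler0n ?(ltW r0).
Qed.

Section ModerateDeviations.
Context {R : realType} {X : finType}.
Variables (W0 : X -> X -> R) (P0 : X -> R) (g : X -> X -> R) (h : X -> R).
Hypotheses (hW0 : transition_matrix W0) (hP0 : distribution_on P0).
Variables (a b : X -> R) (eta0 s2 t : R).
Hypothesis Ha : forall y, \sum_x W0 x y * (g x y - eta0 + a x - a y) = 0.
Hypothesis Hb :
  forall y, \sum_x W0 x y * ((g x y - eta0 + a x - a y) ^+ 2 + b x - b y) = s2.
Hypotheses (t0 : 0 < t) (t1 : t < 1 / 2).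

(** The slope [s / n^t] enters the neighbourhood of [mgf_bounds] once [n^t > |s| / d]. Its square
    times [n] is [n^(1 - 2t) s^2], and its product with [z] is [n^(1 - 2t) s (z / n^(1 - t))]. *)
Lemma scaled_mgf_bounds (s k : R) : 0 < k -> \forall n \near \oo,
  8^-1 * expR (n%:R `^ (1 - 2 * t) * (s ^+ 2 * ((s2 - k) / 2))) <=
  \sum_(x : {ffun 'I_n.+1 -> X}) path_prob P0 W0 x *
    expR (n%:R `^ (1 - 2 * t) *
          (s * ((g_tilde g h x - n%:R * eta0) / n%:R `^ (1 - t)))) <=
  8 * expR (n%:R `^ (1 - 2 * t) * (s ^+ 2 * ((s2 + k) / 2))).
Proof.
move=> k0; have [d d0 Hd] := near0P (mgf_bounds h hW0 hP0 k0 Ha Hb).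
have /cvgryPgt/(_ 0) n0 := cvgr_idn (R := R).
have /cvgryPgt/(_ (`|s| / d)) nt := cvgy_powR_nat t0.
apply: filterS2 n0 nt => n n0 nt.
have r0 : 0 < n%:R `^ t :> R by exact: powR_gt0.
have nN : n%:R != 0 :> R by rewrite gt_eqF.
have E1 : n%:R `^ (1 - 2 * t) = n%:R / (n%:R `^ t) ^+ 2.
  rewrite powRD ?nN ?implybT// powRr1 ?ltW// powRN; congr (_ / _).
  by rewrite expr2 -powRD ?nN ?implybT//; congr (_ `^ _); ring.
have E2 : n%:R `^ (1 - t) = n%:R / n%:R `^ t.
  by rewrite powRD ?nN ?implybT// powRr1 ?ltW// powRN.
have := Hd (s / n%:R `^ t).
rewrite normrM normfV (gtr0_norm r0) ltr_pdivrMr// mulrC -ltr_pdivrMr// => /(_ nt n).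
rewrite E1 E2; move: (n%:R `^ t) r0 => r r0.
have N z : n%:R * ((s / r) ^+ 2 * z) = n%:R / r ^+ 2 * (s ^+ 2 * z).
  by field; rewrite gt_eqF.
have N' z : s / r * z = n%:R / r ^+ 2 * (s * (z / (n%:R / r))).
  by field; rewrite !gt_eqF.
by rewrite !N; under eq_bigr do rewrite N'.
Qed.

End ModerateDeviations.

Theorem corollary8p4 (R : realType) (X : finType)
  (W0 : X -> X -> R) (P0 : X -> R) (g : X -> X -> R) (h : X -> R)
  (hW0 : transition_matrix W0) (hW0_erg : ergodic W0)
  (hP0 : distribution_on P0)
  (hg : ~ exists (f : X -> R) (c : R),
      forall x y : X, 0 < W0 x y -> g x y = f x - f y + c)
  (t delta : R) (ht0 : 0 < t) (ht1 : t < 1 / 2) (hdelta : 0 < delta) :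
  ((fun n : nat =>
      - (1 / n%:R `^ (1 - 2 * t)) *
      ln (chain_Pr P0 W0 (fun x : {ffun 'I_n.+1 -> X} =>
            g_tilde g h x - n%:R * eta W0 g 0 >= n%:R `^ (1 - t) * delta)))
     @ \oo --> delta ^+ 2 / (2 * derive1n 2 (phi W0 g) 0))
  /\
  ((fun n : nat =>
      - (1 / n%:R `^ (1 - 2 * t)) *
      ln (chain_Pr P0 W0 (fun x : {ffun 'I_n.+1 -> X} =>
            g_tilde g h x - n%:R * eta W0 g 0 <= - (n%:R `^ (1 - t) * delta))))
     @ \oo --> delta ^+ 2 / (2 * derive1n 2 (phi W0 g) 0)).
Proof.
have [iW _] := hW0_erg.
have X0 : (0 < #|X|)%N.
  rewrite lt0n; apply/eqP => /card0_eq X0; have [_ /eqP] := hP0.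
  by rewrite big1 ?(eq_sym 0) ?oner_eq0// => x; have := X0 x.
have [a [b [eta0 [s2 [s20 Ha Hb]]]]] := variance_data hW0 iW hg.
have [E1 E2] := phi_derivatives hW0 iW X0 Ha Hb.
rewrite /eta E1 E2 => {E1 E2}.
have pp n (x : {ffun 'I_n.+1 -> X}) : 0 <= path_prob P0 W0 x.
  rewrite mulr_ge0 ?(hP0.1)// prodr_ge0// => i _.
  exact: (hW0 _).1.
have a_oo : n%:R `^ (1 - 2 * t) @[n --> \oo] --> (+oo : set_system R).
  by apply: cvgy_powR_nat; lra.
(* At [n = 0] the divisor in [Z] is 0, so the events are rewritten through [Z] for positive [n]
   only. *)
have /cvgryPgt/(_ 0) n0 := cvgr_idn (R := R).
pose Z n (x : {ffun 'I_n.+1 -> X}) :=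
  (g_tilde g h x - n%:R * eta0) / n%:R `^ (1 - t).
have M s k : 0 < k -> exists2 C, 0 < C & \forall n \near \oo,
    C^-1 * expR (n%:R `^ (1 - 2 * t) * (s ^+ 2 * ((s2 - k) / 2))) <=
    \sum_(x : {ffun 'I_n.+1 -> X}) path_prob P0 W0 x *
       expR (n%:R `^ (1 - 2 * t) * (s * Z n x)) <=
    C * expR (n%:R `^ (1 - 2 * t) * (s ^+ 2 * ((s2 + k) / 2))).
  by move=> k0; exists 8 => //; exact: scaled_mgf_bounds.
(* The lower tail is the upper tail of [- Z]; the bounds are even in [s], so they pass to [- Z]. *)
have M' s k : 0 < k -> exists2 C, 0 < C & \forall n \near \oo,
    C^-1 * expR (n%:R `^ (1 - 2 * t) * (s ^+ 2 * ((s2 - k) / 2))) <=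
    \sum_(x : {ffun 'I_n.+1 -> X}) path_prob P0 W0 x *
       expR (n%:R `^ (1 - 2 * t) * (s * - Z n x)) <=
    C * expR (n%:R `^ (1 - 2 * t) * (s ^+ 2 * ((s2 + k) / 2))).
  move=> k0; have [C C0 H] := M (- s) k k0; exists C => //; apply: filterS H => n.
  by rewrite sqrrN; under eq_bigr do rewrite mulNr -mulrN.
split.
  apply: cvg_trans (quadratic_deviations (T := fun n => {ffun 'I_n.+1 -> X})
    pp a_oo s20 M hdelta); apply: near_eq_cvg.
  apply: filterS n0 => n n0; rewrite /= div1r; congr (_ * ln _).
  apply: eq_bigl => x; rewrite /Z ler_pdivlMr ?powR_gt0//.
  by rewrite mulrC.
apply: cvg_trans (quadratic_deviations (T := fun n => {ffun 'I_n.+1 -> X})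
  (Z := fun n x => - Z n x) pp a_oo s20 M' hdelta); apply: near_eq_cvg.
apply: filterS n0 => n n0; rewrite /= div1r; congr (_ * ln _).
apply: eq_bigl => x; rewrite /Z -mulNr ler_pdivlMr ?powR_gt0// lerNr.
by rewrite [delta * _]mulrC.
Qed.
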